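(* Let $f_0:[-1,1]\to\mathbb{R}$ be a nondecreasing square-integrable function that is continuous at $0$. Choose $\alpha\in(0,1)$ and $\beta\in(0,1/2)$. Consider the white noise model with noise level $n^{-1/2}$ and the monotone least squares estimator $\hat f(0)$ at $0$. There exists $\eta>0$ such that for all $n$ large enough we can find a nondecreasing square-integrable function $f_1=f_{1,n}$ on $[-1,1]$ and a rate $\gamma_n>0$ with $$\limsup_{n\to\infty}\ \max_{i=0,1}\ \mathbb{P}_{f_i}\big(|\hat f(0)-f_i(0)|\ge\gamma_n\big)\le\alpha$$ and $$\liminf_{n\to\infty}\ \inf_{\hat\theta}\ \max_{i=0,1}\ \mathbb{P}_{f_i}\big(|\hat\theta(Y)-f_i(0)|\ge\eta\cdot\gamma_n\big)>\beta,$$ where the infimum is over all estimators $\hat\theta(Y)$ of $f(0)$, i.e. all real-valued measurable functions of the data $Y$.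
   Context: White noise model: under $\mathbb{P}_f$ one observes $Y(t)=\int_0^t f(s)\,ds+n^{-1/2}W(t)$, $t\in[-1,1]$, where $W$ is standard two-sided Brownian motion. Estimator: $\hat F(t)=\sup\{\phi(t):\phi\text{ affine and }\phi(s)\le Y(s)\ \forall s\in[-1,1]\}$ (greatest convex minorant of $Y$) and $\hat f(t)=\lim_{h\downarrow0}(\hat F(t)-\hat F(t-h))/h$ for $t\in(-1,1)$. The function $f_1$ is allowed to depend on $n$, while $\eta$ does not depend on $n$. *)

(* Defs.v *)
From HB Require Import structures.
From mathcomp Require Import all_boot all_order all_algebra.
From mathcomp Require Import all_classical all_reals all_analysis.
Set Implicit Arguments.
Unset Strict Implicit.
Unset Printing Implicit Defensive.
Import Order.TTheory GRing.Theory Num.Theory.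
Import numFieldNormedType.Exports.
Local Open Scope classical_set_scope.
Local Open Scope ring_scope.

(* Functions on [-1, 1] are represented by total functions R -> R, of which
   only the values on [-1, 1] matter. *)

Definition nondecreasing_11 (R : realType) (f : R -> R) : Prop :=
  {in `[-1, 1]%R &, {homo f : x y / x <= y}}.

Definition square_integrable_11 (R : realType) (f : R -> R) : Prop :=
  measurable_fun (`[-1, 1] : set R) f /\
  (@lebesgue_measure R).-integrable `[-1, 1] (fun x => (f x ^+ 2)%:E).

(* The oriented integral of f from 0 to t. *)
Definition primitive0 (R : realType) (f : R -> R) (t : R) : R :=
  if 0 <= t then \int[@lebesgue_measure R]_(s in `[0, t]) f s
  else - \int[@lebesgue_measure R]_(s in `[t, 0]) f s.

(* The second argument of normal_prob is the standard deviation.  All paths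
   are continuous, not just almost all: this makes the events on the greatest
   convex minorant of a path measurable even if P is not complete. *)
Record two_sided_brownian d (T : measurableType d) (R : realType)
    (P : probability T R) (W : R -> {RV P >-> R}) : Prop := {
  brownian0 : forall w, W 0 w = 0 ;
  brownian_continuous : forall w, continuous (fun t => W t w) ;
  brownian_normal : forall (s t : R) (B : set R), s < t -> measurable B ->
    P [set w | B (W t w - W s w)] = normal_prob 0 (Num.sqrt (t - s)) B ;
  brownian_indep : forall (k : nat) (t : nat -> R) (B : nat -> set R),
    (forall i, (i < k)%N -> t i < t i.+1) -> (forall i, measurable (B i)) ->
    P (\bigcap_(i < k) [set w | B i (W (t i.+1) w - W (t i) w)]) =
    (\prod_(i < k) P [set w | B i (W (t i.+1)%R w - W (t i) w)%R])%E
}.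

(* Y(t), at noise level n^(-1/2); only n > 0 and t in [-1, 1] are relevant. *)
Definition observation d (T : measurableType d) (R : realType)
    (P : probability T R) (W : R -> {RV P >-> R}) (n : nat) (f : R -> R)
    (w : T) : R -> R :=
  fun t => primitive0 f t + (Num.sqrt n%:R)^-1 * W t w.

(* P_f(Y \in A) *)
Definition law d (T : measurableType d) (R : realType)
    (P : probability T R) (W : R -> {RV P >-> R}) (n : nat) (f : R -> R)
    (A : set (R -> R)) : \bar R :=
  P (observation W n f @^-1` A).

Definition sample_space (R : realType) : set (R -> R) :=
  [set y : R -> R | {within `[-1, 1], continuous y}].

Definition cylinders (R : realType) : set_system (R -> R) :=
  [set A | exists (t : R) (B : set R), [/\ t \in `[-1, 1]%R, measurable B &
    A = [set y | sample_space y /\ B (y t)]]].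

(* Measurable functions on C([-1, 1]), equipped with the sigma-algebra
   generated by the evaluations (which is its Borel sigma-algebra).
   [measurable_fun] on [sample_space] in the product sigma-algebra would be
   vacuous, as [sample_space] is not in that sigma-algebra. *)
Definition estimator (R : realType) : set ((R -> R) -> R) :=
  [set theta | forall B : set R, measurable B ->
    <<s @sample_space R, @cylinders R >>
      [set y | sample_space y /\ B (theta y)]].

(* Greatest convex minorant of y on [-1, 1]. *)
Definition gcm (R : realType) (y : R -> R) (t : R) : R :=
  sup [set v | exists a b : R,
    (forall s, s \in `[-1, 1]%R -> a * s + b <= y s) /\ v = a * t + b].

Definition monotone_lse (R : realType) (t : R) (y : R -> R) : R :=
  lim ((gcm y t - gcm y (t - h)) / h @[h --> 0^'+]).

(* P_f(|theta(Y) - f(0)| >= r) *)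
Definition error_prob d (T : measurableType d) (R : realType)
    (P : probability T R) (W : R -> {RV P >-> R}) (n : nat)
    (theta : (R -> R) -> R) (f : R -> R) (r : R) : \bar R :=
  law W n f [set y | r <= `|theta y - f 0|].

(* Main.v *)
Require Import Defs.
From HB Require Import structures.
From mathcomp Require Import all_boot all_order all_algebra.
From mathcomp Require Import all_classical all_reals all_analysis.
From mathcomp Require Import measurable_realfun.
From mathcomp Require Import ring lra.
Set Implicit Arguments.
Unset Strict Implicit.
Unset Printing Implicit Defensive.
Import Order.TTheory GRing.Theory Num.Theory.
Import numFieldNormedType.Exports.
Local Open Scope classical_set_scope.
Local Open Scope ring_scope.

(** The rate is read off [f0] itself.  On the right of 0, let [delta = 4^-k] be
    the largest scale at which the oscillation [f0 delta - f0 0] is at most the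
    noise level [(n delta)^(-1/2)] of an average over a window of length
    [delta].  Do the same on the left, and let [r] be the larger of the two
    noise levels.  The estimation error at 0 is of order [r], and no estimator
    does better at both [f0] and a suitable [f1].

    Upper bound.  If all chords of the path [Y] from [s <= 0] to [delta] have
    slope at most [m], then so has the left derivative at 0 of the greatest
    convex minorant ([monotone_lse_le]; [monotone_lse_ge] is the counterpart on
    the left).  Monotonicity bounds the drift part of these slopes by
    [f delta], and the noise part is at most [C (n delta)^(-1/2)] with large
    probability, with a [C] that is the same at all scales
    ([brownian_modulus], by chaining).

    Lower bound.  Let [f1] be the maximum of [f0] and [f0 0 + kappa r] on the
    right of 0, if the noise level is larger there, and otherwise the minimum of
    [f0] and [f0 0 - kappa r] on the left.  By the choice of [delta], it differs
    from [f0] by at most [kappa r], only on an interval of length [4 delta], so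
    that [n |f1 - f0|^2 <= 4 kappa^2] in
    [L^2] ([exists_alternative]).  For small [kappa] the two laws of [Y] are
    then close in total variation ([shifted_law_le]), while an estimator that is
    precise under both would tell them apart ([minimax_lower_bound]).  The
    function [f1] keeps the bounds on the oscillation of [f0], up to a factor 2,
    so that the upper bound holds for it with the same [r].

    The comparison of the two laws does not construct a density.  Let [P_e] be
    the law of [Y] for the drift [f0 + e (f1 - f0)].  By Cauchy-Schwarz,
    Gaussian measures satisfy [P_1(B)^2 <= K P_0(B) P_2(B)], where [K] is the
    exponential of the energy of the shift; this is multiplicative, hence true
    for events on finitely many independent increments.  It says that
    [2 P_1 <= s P_0 + (K / s) P_2] for all [s > 0], and this linear form passes
    to disjoint unions and monotone limits, so that it spreads from
    quantized increments to all events on the path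
    ([dominated_sigma_algebra], used twice).  Applied to an event with
    [s = 1 + eps] and to its complement with [s = 1], it gives
    [P_1 <= P_0 + eps] as soon as [K <= 1 + eps^2]. *)

(** * Preliminaries *)

Lemma measurable_norm_ge d (T : measurableType d) (R : realType) (X : T -> R)
    (r : R) : measurable_fun [set: T] X -> measurable [set w | r <= `|X w|].
Proof.
move=> mX; rewrite (_ : mkset _ = setT `&` (fun w => `|X w|) @^-1` `[r, +oo[).
  by apply: (measurableT_comp _ mX) => //; exact: measurable_itv.
by apply/seteqP; split => w /=; rewrite in_itv/= andbT// => -[].
Qed.

(** The scaled linear inequalities are an equivalent form of [y ^+ 2 <= x * z]: the
    former are additive in [(x, y, z)], the latter is multiplicative.  Both are
    used, for unions of events and for independent events respectively. *)
Lemma le_sqr_of_scaled (R : realFieldType) (x y z : R) : 0 <= x -> 0 <= y -> 0 <= z ->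
  (forall t, 0 < t -> 2 * y <= t * x + z / t) -> y ^+ 2 <= x * z.
Proof.
move=> x0 y0 z0 h; have [->|yn] := eqVneq y 0; first by rewrite expr0n/= mulr_ge0.
have yp : 0 < y by rewrite lt_neqAle eq_sym yn.
move: x0; rewrite le_eqVlt => /predU1P[xe|xp].
  (* For [x = 0], any [t > z / y] gives [2 * y <= z / t < y]. *)
  have tp : 0 < z / y + 1 by rewrite ltr_wpDl// divr_ge0.
  have := h _ tp; rewrite -xe mulr0 add0r ler_pdivlMr// mulrDr mulr1.
  have -> : 2 * y * (z / y) = 2 * z by field.
  lra.
have tp : 0 < y / x by rewrite divr_gt0.
have := h _ tp; rewrite (_ : y / x * x = y); last by field; rewrite gt_eqF.
rewrite (_ : z / (y / x) = x * z / y); last by field; rewrite yn gt_eqF.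
rewrite -lerBlDl (_ : 2 * y - y = y); last by ring.
by rewrite ler_pdivlMr// expr2.
Qed.

Lemma le_scaled_of_sqr (R : realFieldType) (x y z t : R) :
  0 < t -> 0 <= x -> 0 <= y -> 0 <= z ->
  y ^+ 2 <= x * z -> 2 * y <= t * x + z / t.
Proof.
move=> t0 x0 y0 z0 h.
have -> : t * x + z / t = (t ^+ 2 * x + z) / t by field; rewrite gt_eqF.
rewrite ler_pdivlMr//.
have l0 : 0 <= 2 * y * t by rewrite !mulr_ge0// ltW.
have r0 : 0 <= t ^+ 2 * x + z by rewrite addr_ge0// mulr_ge0// exprn_ge0// ltW.
rewrite -ler_sqr ?nnegrE//.
have : 0 <= (t ^+ 2 * x - z) ^+ 2 by rewrite sqr_ge0.
have : 4 * t ^+ 2 * y ^+ 2 <= 4 * t ^+ 2 * (x * z).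
  by rewrite ler_wpM2l// mulr_ge0// sqr_ge0.
by nra.
Qed.

(** * Gaussian estimates *)

Section gaussian.
Context {R : realType}.
Local Notation mu := (@lebesgue_measure R).
Implicit Types (s m x : R) (A : set R).

Lemma lebesgue_measure_shift (m : R) A : measurable A ->
  pushforward mu (shift m : R -> measurableTypeR R) A = mu A.
Proof.
move=> mA; have ms : measurable_fun [set: R] (shift m : R -> measurableTypeR R).
  exact: measurable_funD.
apply/esym/lebesgue_measure_unique => //= _ [[a b]] _ <-.
rewrite /pushforward /=.
have -> : shift m @^-1` `]a, b]%classic = `]a - m, b - m]%classic.
  apply/seteqP; split => x /=; rewrite !in_itv/= => /andP[? ?]; lra.
rewrite !lebesgue_measure_itv/= !lte_fin ltrD2r.
by case: ifP => // _; rewrite -!EFinB; congr EFin; ring.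
Qed.

(** Stated for the centred law, so that events on a drifted increment become one
    fixed event under normal laws with different means. *)
Lemma normal_prob_shift s m A : s != 0 -> measurable A ->
  normal_prob 0 s [set x | A (x + m)] = normal_prob m s A.
Proof.
move=> s0 mA; rewrite /normal_prob.
have ms : measurable_fun [set: R] (shift m : R -> measurableTypeR R).
  exact: measurable_funD.
transitivity (\int[pushforward mu (shift m : R -> measurableTypeR R)]_(x in A)
    (normal_pdf m s x)%:E)%E.
  rewrite ge0_integral_pushforward//.
  - apply: eq_integral => x _ /=; congr EFin.
    by rewrite !normal_pdfE// /normal_fun subr0 addrK.
  - by apply/measurable_EFinP; apply: measurable_funTS; exact: measurable_normal_pdf.
  - by move=> y _; rewrite lee_fin normal_pdf_ge0.
by apply: eq_measure_integral => //= B mB _; exact: lebesgue_measure_shift.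
Qed.

(** The parallelogram identity [x^2 + (x - 2m)^2 = 2(x - m)^2 + 2m^2] in the
    exponents. *)
Lemma normal_pdf_sq s m x : s != 0 ->
  normal_pdf m s x ^+ 2 =
  expR (m ^+ 2 / s ^+ 2) * (normal_pdf 0 s x * normal_pdf (2 * m) s x).
Proof.
move=> s0; rewrite !normal_pdfE// /normal_fun.
have E : expR (- (x - m) ^+ 2 / (s ^+ 2 *+ 2)) ^+ 2 = expR (m ^+ 2 / s ^+ 2) *
    (expR (- (x - 0) ^+ 2 / (s ^+ 2 *+ 2)) *
     expR (- (x - 2 * m) ^+ 2 / (s ^+ 2 *+ 2))).
  by rewrite -expRM_natl -!expRD; congr expR; field.
by rewrite exprMn E; ring.
Qed.

Lemma normal_prob_fin m s A : measurable A -> normal_prob m s A \is a fin_num.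
Proof. by move=> mA; apply: fin_num_measure. Qed.

(** Cauchy-Schwarz for the factorisation of the density with mean [m] given by
    [normal_pdf_sq]. *)
Lemma normal_prob_sq s m A : s != 0 -> measurable A ->
  fine (normal_prob m s A) ^+ 2 <=
  expR (m ^+ 2 / s ^+ 2) *
  (fine (normal_prob 0 s A) * fine (normal_prob (2 * m) s A)).
Proof.
move=> s0 mA; set K := expR _; have K0 : 0 < K by exact: expR_gt0.
have fge n : 0 <= fine (normal_prob n s A) by rewrite fine_ge0.
rewrite mulrCA; apply: le_sqr_of_scaled; rewrite ?fge ?mulr_ge0 ?fge ?(ltW K0)//.
move=> t t0; suff : (2%:E * normal_prob m s A <=
    t%:E * normal_prob 0 s A + (K / t)%:E * normal_prob (2 * m) s A)%E.
  rewrite -(fineK (normal_prob_fin m s mA)) -(fineK (normal_prob_fin 0 s mA)).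
  rewrite -(fineK (normal_prob_fin (2 * m) s mA)) -!EFinM -EFinD lee_fin /=.
  by rewrite [K * _ / t]mulrAC.
have mp n : measurable_fun A (EFin \o normal_pdf n s).
  apply/measurable_EFinP; apply: measurable_funTS; exact: measurable_normal_pdf.
rewrite /normal_prob -!ge0_integralZl//=
  ?lee_fin ?mulr_ge0 ?invr_ge0 ?(ltW t0) ?(ltW K0)//;
  try by [exact: mp | move=> x _; rewrite lee_fin normal_pdf_ge0].
rewrite -ge0_integralD//=; last 4 first.
- by move=> x _; apply: mule_ge0; rewrite lee_fin ?normal_pdf_ge0// ltW.
- apply: measurable_funeM; exact: mp.
- by move=> x _; apply: mule_ge0; rewrite lee_fin ?normal_pdf_ge0// divr_ge0// ltW.
- apply: measurable_funeM; exact: mp.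
apply: ge0_le_integral => //=.
- by move=> x _; apply: mule_ge0; rewrite lee_fin ?normal_pdf_ge0.
- apply: measurable_funeM; exact: mp.
- by apply: emeasurable_funD; apply: measurable_funeM; exact: mp.
move=> x _; rewrite -!EFinM -EFinD lee_fin mulrAC.
apply: le_scaled_of_sqr; rewrite ?mulr_ge0 ?normal_pdf_ge0 ?(ltW K0)//.
by rewrite normal_pdf_sq// -/K mulrCA.
Qed.

(** A polynomial tail of order 4 is what chaining needs.  On the event, the density
    is at most [64 s^4 / x^4] times the normal density of standard deviation
    [2 s], whose integral is 1. *)
Lemma normal_prob_tail s x : 0 < s -> 0 < x ->
  (normal_prob 0 s [set y | (x <= `|y|)%R] <= (64 * s ^+ 4 / x ^+ 4)%:E)%E.
Proof.
move=> s0 x0; set A := [set y | _]; set c := 64 * _ / _.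
have c0 : 0 <= c by rewrite /c divr_ge0 ?mulr_ge0 ?exprn_ge0// ltW.
have mA : measurable A by apply: measurable_norm_ge; exact: measurable_id.
have mp n : measurable_fun A (EFin \o normal_pdf 0 n).
  apply/measurable_EFinP; apply: measurable_funTS; exact: measurable_normal_pdf.
apply: (@le_trans _ _ (c%:E * normal_prob 0 (2 * s) A)%E); last first.
  by rewrite -[leRHS]mule1 lee_wpmul2l ?lee_fin// probability_le1.
rewrite /normal_prob -ge0_integralZl//=; last 2 first.
- exact: mp.
- by move=> y _; rewrite lee_fin normal_pdf_ge0.
apply: ge0_le_integral => //=.
- by move=> y _; rewrite lee_fin normal_pdf_ge0.
- exact: mp.
- apply: measurable_funeM; exact: mp.
move=> y xy; rewrite -EFinM lee_fin !normal_pdfE ?mulf_neq0 ?gt_eqF//.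
(* With [w = y^2 / (8 s^2)], the ratio of the two densities is [2 exp (-3 w)],
   and [exp (-3 w)] is at most a multiple of [w^-2]. *)
have -> : normal_peak (2 * s) = normal_peak s / 2.
  rewrite /normal_peak -invfM; congr (_^-1).
  rewrite (_ : (2 * s) ^+ 2 * pi *+ 2 = s ^+ 2 * pi *+ 2 * 2 ^+ 2); last by ring.
  by rewrite sqrtrM ?sqrtr_sqr ?ger0_norm// mulrn_wge0// mulr_ge0 ?pi_ge0 ?sqr_ge0.
rewrite /normal_fun !subr0.
set w := y ^+ 2 / (8 * s ^+ 2); have w0 : 0 <= w.
  by rewrite divr_ge0 ?sqr_ge0// mulr_ge0 ?sqr_ge0.
have -> : - y ^+ 2 / (s ^+ 2 *+ 2) = - w + 2 * - (3 / 2 * w).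
  by rewrite /w; field; rewrite gt_eqF.
have -> : - y ^+ 2 / ((2 * s) ^+ 2 *+ 2) = - w.
  by rewrite /w; field; rewrite gt_eqF.
rewrite expRD expRM_natl mulrA; set p := normal_peak s * expR (- w).
have p0 : 0 <= p by rewrite mulr_ge0 ?expR_ge0 ?normal_peak_ge0.
rewrite (_ : c * _ = p * (c / 2)); last by rewrite /p; ring.
apply: ler_wpM2l => //.
have y4 : x ^+ 4 <= y ^+ 4.
  rewrite -[y ^+ 4]ger0_norm ?exprn_even_ge0// normrX.
  by rewrite ler_pXn2r ?nnegrE// ltW.
have e0 : 0 < expR (- (3 / 2 * w)) by exact: expR_gt0.
have e1 : expR (- (3 / 2 * w)) * (3 / 2 * w) <= 1.
  have := expR_ge1Dx (3 / 2 * w); rewrite expRN ler_pdivrMl ?expR_gt0// mulr1; lra.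
have e2 : (expR (- (3 / 2 * w)) * (3 / 2 * w)) ^+ 2 <= 1.
  by apply: exprn_ile1 => //; apply: mulr_ge0; [exact: ltW | lra].
rewrite ler_pdivlMr// /c ler_pdivlMr ?exprn_gt0//.
rewrite (@le_trans _ _ (expR (- (3 / 2 * w)) ^+ 2 * 2 * y ^+ 4))//.
  by rewrite ler_wpM2l// mulr_ge0// sqr_ge0.
have -> : y ^+ 4 = (8 * s ^+ 2) ^+ 2 * w ^+ 2 by rewrite /w; field; rewrite gt_eqF.
move: e2; set e := expR _ => e2.
have s4 : 0 <= s ^+ 4 by rewrite exprn_ge0// ltW.
have : s ^+ 4 * (e * (3 / 2 * w)) ^+ 2 <= s ^+ 4 * 1 by rewrite ler_wpM2l.
have := mulr_ge0 s4 (sqr_ge0 (e * w)).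
nra.
Qed.

End gaussian.

(** * Extending a domination of laws from an algebra to its sigma-algebra *)

Section domination.
Context d (T : measurableType d) (R : realType) (P : probability T R).
Context (U : Type) (Y0 Y1 Y2 : T -> U) (a b : R).
Implicit Types A B : set U.

(** For [a = s] and [b = K / s] with [s > 0] arbitrary, this is the inequality
    [P_1(A)^2 <= K P_0(A) P_2(A)] between the laws of the three maps, in its
    additive form.  The measurability of the preimages is included because
    no sigma-algebra is fixed on [U]. *)
Definition dominated A :=
  [/\ measurable (Y0 @^-1` A), measurable (Y1 @^-1` A),
      measurable (Y2 @^-1` A) &
      (2%:E * P (Y1 @^-1` A) <=
       a%:E * P (Y0 @^-1` A) + b%:E * P (Y2 @^-1` A))%E].

Lemma dominated0 : dominated set0.
Proof. by split; rewrite !preimage_set0 ?measure0 ?mule0 ?adde0. Qed.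

Lemma dominatedU A B : A `&` B = set0 -> dominated A -> dominated B ->
  dominated (A `|` B).
Proof.
move=> AB0 [A0 A1 A2 lA] [B0 B1 B2 lB].
have dj (Y : T -> U) : (Y @^-1` A) `&` (Y @^-1` B) = set0.
  by rewrite -preimage_setI AB0 preimage_set0.
split; rewrite ?preimage_setU; try exact: measurableU.
rewrite !measureU// !ge0_muleDr//.
by rewrite addeACA; exact: leeD.
Qed.

Lemma dominated_finite (J : finType) (g : U -> J) (S : pred J) :
  (forall j, dominated (g @^-1` [set j])) -> dominated [set y | S (g y)].
Proof.
move=> gj; rewrite (_ : mkset _ = [set y | g y \in enum S]); last first.
  by apply/seteqP; split => y /=; rewrite mem_enum.
elim: (enum S) (enum_uniq S) => [_|j s IH /= /andP[js us]].
  rewrite (_ : mkset _ = set0); first exact: dominated0.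
  by apply/seteqP; split.
rewrite (_ : mkset _ = g @^-1` [set j] `|` [set y | g y \in s]).
  apply: dominatedU => //; last exact: IH.
  by apply/seteqP; split => y //= [->]; rewrite (negbTE js).
apply/seteqP; split => y /=; rewrite inE.
  by case/orP=> [/eqP|]; [left|right].
by case=> [->|->]; rewrite ?eqxx ?orbT.
Qed.

Lemma dominated_cvg (F : nat -> set U) (A : set U) :
  (forall i, dominated (F i)) ->
  (forall Y : T -> U, (forall i, measurable (Y @^-1` F i)) ->
    measurable (Y @^-1` A) /\
    (fun i => P (Y @^-1` F i)) @ \oo --> P (Y @^-1` A)) ->
  dominated A.
Proof.
move=> dF cA.
have m0 i : measurable (Y0 @^-1` F i) by case: (dF i).
have m1 i : measurable (Y1 @^-1` F i) by case: (dF i).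
have m2 i : measurable (Y2 @^-1` F i) by case: (dF i).
have [A0 c0] := cA _ m0; have [A1 c1] := cA _ m1; have [A2 c2] := cA _ m2.
split => //; apply: (@lee_cvg_to _ \oo _ _ (fun i => 2%:E * P (Y1 @^-1` F i))%E
  (fun i => a%:E * P (Y0 @^-1` F i) + b%:E * P (Y2 @^-1` F i))%E).
- exact: cvgeZl.
- apply: cvgeD; try exact: cvgeZl.
  by rewrite fin_num_adde_defl// fin_numM// fin_num_measure.
- by apply: nearW => i; case: (dF i).
Qed.

Lemma dominated_monotone : monotone dominated.
Proof.
split=> F mF dF; apply: (dominated_cvg dF) => Y mY.
- rewrite preimage_bigcup.
  have mU : measurable (\bigcup_i (Y @^-1` F i)) by exact: bigcupT_measurable.
  split => //; apply: nondecreasing_cvg_mu => // i j /mF/subsetPset FF.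
  by apply/subsetPset; exact: preimage_subset.
- rewrite preimage_bigcap.
  have mI : measurable (\bigcap_i (Y @^-1` F i)) by exact: bigcapT_measurable.
  split => //; apply: nonincreasing_cvg_mu => //.
    by rewrite ltey_eq fin_num_measure.
  by move=> i j /mF/subsetPset FF; apply/subsetPset; exact: preimage_subset.
Qed.

(** The monotone class theorem, since [dominated] is not stable under
    complements. *)
Lemma dominated_sigma_algebra (G : set_system U) :
  G `<=` dominated -> G setT -> setC_closed G -> setU_closed G ->
  <<s G >> `<=` dominated.
Proof.
move=> Gd GT GC GU.
have rG : setring G.
  split => //; first by rewrite -setCT; exact: GC.
  by move=> A B GA GB; rewrite setDE -[A]setCK -setCU; apply/GC/GU => //; exact: GC.
have sub : <<s G >> `<=` <<sr G >>.
  apply: smallest_sub; last exact: sub_smallest.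
  have [s0 sD sU] := smallest_sigma_ring G.
  split => // A sA; apply: sD => //; exact: sub_g_sigma_ring.
apply: (subset_trans sub); apply: monotone_setring_sub_g_sigma_ring => //.
exact: dominated_monotone.
Qed.

End domination.

(** * Shifted Brownian paths on a finite grid *)

Section girsanov.
Context d (T : measurableType d) (R : realType) (P : probability T R)
        (W : R -> {RV P >-> R}).
Hypothesis HW : two_sided_brownian W.
Context (c : R) (D h u : R -> R) (M L : R).
Hypotheses (c0 : 0 < c) (M0 : 0 <= M).
Hypothesis hu : forall a b, a \in `[-1, 1]%R -> b \in `[-1, 1]%R -> a < b ->
  `|h b - h a| <= M * (u b - u a).
Hypothesis u1 : forall a b, a < b -> 0 <= u b - u a <= b - a.
Hypothesis uL : forall a b, a < b -> u b - u a <= L.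

(** The observations under the two hypotheses are [e = 0] and [e = 1]; [e = 2] is the
    mirror image of the former in the latter. *)
Definition drifted (e : R) (w : T) : R -> R :=
  fun t => D t + e * h t + c * W t w.

Let K := expR (M ^+ 2 * L / c ^+ 2).

Section grid.
Context (k : nat) (t : nat -> R).
Hypothesis tI : forall i, (i <= k)%N -> t i \in `[-1, 1]%R.
Hypothesis t_lt : forall i, (i < k)%N -> t i < t i.+1.

Definition incr (i : nat) (y : R -> R) : R := y (t i.+1) - y (t i).

Lemma increments_prob (e : R) (B : nat -> set R) :
  (forall i, measurable (B i)) ->
  P (drifted e @^-1` (\bigcap_(i < k) (incr i @^-1` B i))) =
  (\prod_(i < k) fine (normal_prob (e * (incr i h / c)) (Num.sqrt (t i.+1 - t i))
     [set x | B i (incr i D + c * x)]))%:E.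
Proof.
move=> mB.
pose B' i := [set x | B i (incr i D + e * incr i h + c * x)].
have maff a : measurable_fun [set: R] (fun x : R => a + c * x).
  exact: measurable_funD.
have mB' i : measurable (B' i).
  by rewrite -[X in measurable X]setTI; exact: maff.
rewrite (_ : _ @^-1` _ =
    \bigcap_(i < k) [set w | B' i (W (t i.+1) w - W (t i) w)]); last first.
  apply/seteqP; split => w /= H i ik; have := H i ik => /=;
    rewrite /B' /incr /drifted /=;
    by congr (B i _); ring.
rewrite (brownian_indep HW)// -prodEFin.
apply: eq_bigr => -[i ik] _ /=.
rewrite (brownian_normal HW) ?t_lt//.
have s0 : Num.sqrt (t i.+1 - t i) != 0.
  by rewrite gt_eqF// sqrtr_gt0 subr_gt0 t_lt.
have mA : measurable [set x | B i (incr i D + c * x)].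
  by rewrite -[X in measurable X]setTI; exact: maff.
rewrite fineK; last exact: normal_prob_fin.
rewrite (_ : B' i = [set x | [set x | B i (incr i D + c * x)]
    (x + e * (incr i h / c))]); first exact: normal_prob_shift.
apply/funext => x; rewrite /B' /=; congr (B i _).
by field; rewrite gt_eqF.
Qed.

(** The energy of the shift is bounded by comparison with [u]: the square of
    [M (u b - u a)] is at most [M^2 (u b - u a) (b - a)], and the increments of
    [u] add up to at most [L]. *)
Lemma increments_energy :
  \sum_(i < k) ((incr i h / c) ^+ 2 / (Num.sqrt (t i.+1 - t i)) ^+ 2) <=
  M ^+ 2 * L / c ^+ 2.
Proof.
apply: (@le_trans _ _ (\sum_(i < k) (M ^+ 2 / c ^+ 2 * (u (t i.+1) - u (t i))))).
  apply: ler_sum => -[i ik] _ /=.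
  have tt := t_lt ik; have tp : 0 < t i.+1 - t i by rewrite subr_gt0.
  rewrite sqr_sqrtr ?(ltW tp)// ler_pdivrMr// expr_div_n.
  set v := u _ - u _; set r := t i.+1 - t i.
  have -> : M ^+ 2 / c ^+ 2 * v * r = M ^+ 2 * v * r / c ^+ 2 by ring.
  apply: ler_wpM2r; rewrite ?invr_ge0 ?sqr_ge0//.
  have := hu (tI (ltnW ik)) (tI ik) tt; have /andP[v0 v1] := u1 tt.
  rewrite -/v in v0 v1 * => hv.
  apply: (@le_trans _ _ ((M * v) ^+ 2)).
    by rewrite -[X in X <= _]ger0_norm ?sqr_ge0// normrX ler_pXn2r ?nnegrE// mulr_ge0.
  by rewrite exprMn -mulrA ler_wpM2l ?sqr_ge0// expr2 ler_wpM2l.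
have -> : M ^+ 2 * L / c ^+ 2 = M ^+ 2 / c ^+ 2 * L by ring.
rewrite -mulr_sumr ler_wpM2l ?divr_ge0 ?sqr_ge0//.
rewrite -(big_mkord predT (fun i => u (t i.+1) - u (t i))) telescope_sumr//.
have [->|k0] := posnP k.
  rewrite subrr; apply: le_trans (uL ltr01).
  by have /andP[] := u1 (@ltr01 R).
apply: uL.
have : forall j, (0 < j <= k)%N -> t 0%N < t j.
  elim=> // -[_ /andP[_ k1]|j IH /andP[_ jk]]; first exact: t_lt.
  by apply: lt_trans (t_lt jk); apply: IH; rewrite /= ltnW.
by apply; rewrite k0 leqnn.
Qed.

Context (s : R).
Hypothesis s0 : 0 < s.

Let dom := dominated P (drifted 0) (drifted 1) (drifted 2) s (K / s).

Lemma measurable_increments e (B : nat -> set R) :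
  (forall i, measurable (B i)) ->
  measurable (drifted e @^-1` (\bigcap_(i < k) (incr i @^-1` B i))).
Proof.
move=> mB; rewrite preimage_bigcap; apply: bigcap_measurableType => i _.
have mD j : measurable_fun [set: T] (fun w => drifted e w j).
  by apply: measurable_funD => //; exact: measurable_funM.
rewrite -[X in measurable X]setTI; apply: (measurable_funB (mD _) (mD _)) => //.
Qed.

(** By independence, the inequality of [normal_prob_sq] may be multiplied over the
    increments. *)
Lemma dominated_cell (B : nat -> set R) : (forall i, measurable (B i)) ->
  dom (\bigcap_(i < k) (incr i @^-1` B i)).
Proof.
move=> mB; split; try exact: measurable_increments.
rewrite !increments_prob// -!EFinM -EFinD lee_fin.
rewrite mulrAC; apply: le_scaled_of_sqr => //;
  try by apply: prodr_ge0 => i _; rewrite fine_ge0.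
  by rewrite mulr_ge0 ?expR_ge0//; apply: prodr_ge0 => i _; rewrite fine_ge0.
rewrite -prodrXl mulrCA -big_split/=.
apply: (@le_trans _ _ (\prod_(i < k)
   (expR ((incr i h / c) ^+ 2 / (Num.sqrt (t i.+1 - t i)) ^+ 2) *
   (fine (normal_prob (0 * (incr i h / c)) (Num.sqrt (t i.+1 - t i))
        [set x | B i (incr i D + c * x)]) *
    fine (normal_prob (2 * (incr i h / c)) (Num.sqrt (t i.+1 - t i))
        [set x | B i (incr i D + c * x)]))))).
  apply: ler_prod => -[i ik] _ /=; rewrite sqr_ge0/= mul0r mul1r.
  apply: normal_prob_sq; first by rewrite gt_eqF// sqrtr_gt0 subr_gt0 t_lt.
  rewrite -[X in measurable X]setTI.
  by have : measurable_fun [set: R] (fun x => incr i D + c * x);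
    [exact: measurable_funD | apply].
rewrite big_split/= -expR_sum; apply: ler_wpM2r.
  by apply: prodr_ge0 => i _; rewrite mulr_ge0// fine_ge0.
by rewrite ler_expR; exact: increments_energy.
Qed.

End grid.
End girsanov.

(** * From finite grids to the path space *)

Section path_space.
Context d (T : measurableType d) (R : realType) (P : probability T R)
        (W : R -> {RV P >-> R}).
Hypothesis HW : two_sided_brownian W.
Context (c : R) (D h u : R -> R) (M L : R).
Hypotheses (c0 : 0 < c) (M0 : 0 <= M).
Hypothesis hu : forall a b, a \in `[-1, 1]%R -> b \in `[-1, 1]%R -> a < b ->
  `|h b - h a| <= M * (u b - u a).
Hypothesis u1 : forall a b, a < b -> 0 <= u b - u a <= b - a.
Hypothesis uL : forall a b, a < b -> u b - u a <= L.
Context (s : R).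
Hypothesis s0 : 0 < s.

Let dom := dominated P (drifted W c D h 0) (drifted W c D h 1)
  (drifted W c D h 2) s (expR (M ^+ 2 * L / c ^+ 2) / s).

(** Values are taken relative to the one at 0, in order to be functions of
    increments; on the observations, which start at 0, this changes nothing. *)
Definition values (r : seq R) : set_system (R -> R) :=
  [set A : set (R -> R) | exists (x : R) (B : set R),
    [/\ x \in r, measurable B & A = [set y | B (y x - y 0)]]].

Section grid.
Context (k : nat) (t : nat -> R).
Hypothesis tI : forall i, (i <= k)%N -> t i \in `[-1, 1]%R.
Hypothesis t_lt : forall i, (i < k)%N -> t i < t i.+1.

(** The algebra generated by the increments.  An element is described by one
    quantization [q] of the real line, common to all increments, and a set [S] of
    quantized increments; finer quantizations make unions possible, and each
    element is a finite disjoint union of the cells of [dominated_cell]. *)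
Definition quantized : set_system (R -> R) :=
  [set A | exists (I : finType) (q : R -> I) (S : pred {ffun 'I_k -> I}),
    (forall i, measurable (q @^-1` [set i])) /\
    A = [set y | S [ffun j : 'I_k => q (incr t j y)]]].

Lemma quantized_dominated : quantized `<=` dom.
Proof.
move=> _ [I [q [S [mq ->]]]].
apply: (@dominated_finite _ _ _ _ _ _ _ _ _ _ _
  (fun y : R -> R => [ffun j : 'I_k => q (incr t j y)])) => f.
(* The cell where the quantized increments are [f]. *)
pose B i := if insub i is Some j then q @^-1` [set f j] else setT.
have mB i : measurable (B i).
  by rewrite /B; case: insub => // j; exact: mq.
rewrite (_ : _ @^-1` _ = \bigcap_(i < k) (incr t i @^-1` B i)).
  exact: (@dominated_cell _ _ _ _ _ HW _ _ _ _ _ _ c0 M0 hu u1 uL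
    _ _ tI t_lt _ s0 _ mB).
apply/seteqP; split => y /=.
  by move=> yf i ik; rewrite /B insubT /= -yf ffunE.
move=> H; apply/ffunP => j; rewrite ffunE.
by have := H j (ltn_ord j); rewrite /B /= valK.
Qed.

Lemma quantizedT : quantized setT.
Proof.
exists unit, (fun=> tt), xpredT; split; last by apply/seteqP; split.
by move=> [] /=; rewrite (_ : _ @^-1` _ = setT)//; apply/seteqP; split.
Qed.

Lemma quantizedC : setC_closed quantized.
Proof.
move=> _ [I [q [S [mq ->]]]]; exists I, q, (predC S); split => //.
by apply/seteqP; split => y /= /negP.
Qed.

Lemma quantizedU : setU_closed quantized.
Proof.
move=> _ _ [I [q [S [mq ->]]]] [I' [q' [S' [mq' ->]]]].
exists (I * I')%type, (fun x => (q x, q' x)),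
  (fun f => S [ffun j => (f j).1] || S' [ffun j => (f j).2]); split.
  move=> [i i']; rewrite (_ : _ @^-1` _ = q @^-1` [set i] `&` q' @^-1` [set i']).
    exact: measurableI.
  by apply/seteqP; split => x /= [-> ->].
have E1 y : [ffun j => ([ffun j : 'I_k => (q (incr t j y), q' (incr t j y))] j).1]
    = [ffun j : 'I_k => q (incr t j y)] by apply/ffunP => j; rewrite !ffunE.
have E2 y : [ffun j => ([ffun j : 'I_k => (q (incr t j y), q' (incr t j y))] j).2]
    = [ffun j : 'I_k => q' (incr t j y)] by apply/ffunP => j; rewrite !ffunE.
apply/seteqP; split => y /=; rewrite E1 E2.
  by case=> ->; rewrite ?orbT.
by case/orP => ->; [left|right].
Qed.

Lemma measurable_quantized_incr j : (j < k)%N ->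
  measurable_fun setT (incr t j : g_sigma_algebraType quantized -> R).
Proof.
move=> jk _ B mB; apply: sub_sigma_algebra; rewrite setTI.
exists bool, (fun x => `[< B x >]), (fun f => f (Ordinal jk)); split.
  have BE : (fun x : R => `[< B x >]) @^-1` [set true] = B.
    by apply/seteqP; split => x /= /asboolP.
  case; first by rewrite BE.
  rewrite (_ : _ @^-1` [set false] = ~` B); first exact: measurableC.
  apply/seteqP; split => x /=; first by move/negbT/asboolP.
  by move=> nB; apply/negbTE/asboolP.
by apply/seteqP; split => y /=; rewrite ffunE => /asboolP.
Qed.

Lemma measurable_quantized_value j : (j <= k)%N ->
  measurable_fun setT
    (fun y : g_sigma_algebraType quantized => y (t j) - y (t 0%N)).
Proof.
elim: j => [_|j IH jk].
  rewrite (_ : (fun=> _) = cst 0); first exact: measurable_cst.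
  by apply/funext => y; rewrite subrr.
rewrite (_ : (fun=> _) = (fun y => (y (t j) - y (t 0%N)) + incr t j y)).
  apply: measurable_funD; last exact: measurable_quantized_incr.
  by apply: IH; exact: ltnW.
by apply/funext => y; rewrite /incr; ring.
Qed.

Lemma dominated_grid (r : seq R) (z : nat) : (z <= k)%N -> t z = 0 ->
  (forall x, x \in r -> exists2 j, (j <= k)%N & x = t j) ->
  <<s values r >> `<=` dom.
Proof.
move=> zk tz rt; apply: (@subset_trans _ <<s quantized >>); last first.
  apply: dominated_sigma_algebra => //.
  - exact: quantized_dominated.
  - exact: quantizedT.
  - exact: quantizedC.
  - exact: quantizedU.
apply: smallest_sub; first exact: smallest_sigma_algebra.
move=> _ [x [B [xr mB ->]]]; have [j jk ->] := rt x xr.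
have : measurable_fun setT
    (fun y : g_sigma_algebraType quantized => y (t j) - y (t z)).
  rewrite (_ : (fun=> _) = (fun y => (y (t j) - y (t 0%N)) - (y (t z) - y (t 0%N)))).
    by apply: measurable_funB; exact: measurable_quantized_value.
  by apply/funext => y; ring.
by move=> /(_ measurableT B mB); rewrite setTI tz.
Qed.

End grid.

(** These events form an algebra, because two finite sets of times lie in a
    common one, and it generates the sigma-algebra of the path space. *)
Definition finitely_determined : set_system (R -> R) :=
  [set A | exists2 r : seq R, {subset r <= `[-1, 1]%R} & <<s values r >> A].

Lemma finitely_determined_dominated : finitely_determined `<=` dom.
Proof.
(* Increments need an increasing grid, and relative values need that the time 0
   is one of its points. *)
move=> A [r rI]; pose g := sort <=%R (undup (0 :: r)).
have g_lt : sorted <%R g.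
  rewrite lt_sorted_uniq_le sort_uniq undup_uniq/=.
  by apply: sort_sorted; exact: le_total.
have mem_g x : x \in g = (x \in 0 :: r) by rewrite mem_sort mem_undup.
have gI x : x \in g -> x \in `[-1, 1]%R.
  rewrite mem_g inE => /predU1P[->|]; last exact: rI.
  by rewrite in_itv/= lerN10 ler01.
have g0 : (0 < size g)%N.
  by rewrite -has_predT; apply/hasP; exists 0; rewrite // mem_g inE eqxx.
pose k := (size g).-1.
have kS i : (i <= k)%N = (i < size g)%N by rewrite /k -ltnS prednK.
apply: (@dominated_grid k (nth 0 g) _ _ r (index 0 g)).
- by move=> i; rewrite kS => ik; apply/gI/mem_nth.
- move=> i ik; have ik1 : (i.+1 < size g)%N by rewrite -kS.
  by rewrite lt_sorted_ltn_nth// ?inE ltnW.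
- by rewrite kS index_mem mem_g inE eqxx.
- by apply: nth_index; rewrite mem_g inE eqxx.
- move=> x xr; have xg : x \in g by rewrite mem_g inE xr orbT.
  by exists (index x g); rewrite ?nth_index// kS index_mem.
Qed.

Lemma dominated_finitely_determined : <<s finitely_determined >> `<=` dom.
Proof.
apply: dominated_sigma_algebra => //.
- exact: finitely_determined_dominated.
- exists [::] => //; rewrite -[X in smallest _ _ X]setC0.
  by apply: sigma_algebraC; exact: sigma_algebra0.
- by move=> A [r rI rA]; exists r => //; exact: sigma_algebraC.
- move=> A B [r rI rA] [r' rI' rB]; exists (r ++ r').
    by move=> x; rewrite mem_cat => /orP[/rI|/rI'].
  rewrite -bigcup2E; apply: sigma_algebra_bigcup => -[|[|i]] /=;
    last exact: sigma_algebra0.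
  + apply: sub_sigma_algebra2 rA => _ [x [C [xr mC ->]]].
    by exists x, C; rewrite mem_cat xr.
  + apply: sub_sigma_algebra2 rB => _ [x [C [xr mC ->]]].
    by exists x, C; rewrite mem_cat xr orbT.
Qed.

(** The sigma-algebra of the path space consists of subsets of [sample_space], whereas
    the one generated by [finitely_determined] lives on all functions; on
    continuous paths that start at 0 they have the same events. *)
Lemma sample_space_sigma_algebra E : <<s @sample_space R, @cylinders R >> E ->
  exists2 A, <<s finitely_determined >> A &
    forall y, sample_space y -> y 0 = 0 -> (E y <-> A y).
Proof.
move: E; apply: smallest_sub.
  split.
  - by exists set0; first exact: sigma_algebra0.
  - move=> E [A GA EA]; exists (~` A); first exact: sigma_algebraC.
    move=> y sy y0; have [EAy AEy] := EA y sy y0.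
    by split=> [[_ nE] /AEy //|nA]; split => // /EAy.
  - move=> E EA; have {}EA i : exists A, <<s finitely_determined >> A /\
        forall y, sample_space y -> y 0 = 0 -> (E i y <-> A y).
      by have [A ? ?] := EA i; exists A.
    have [A GA] := choice EA; exists (\bigcup_i A i).
      by apply: sigma_algebra_bigcup => i; case: (GA i).
    move=> y sy y0; split=> -[i _ Hi]; exists i => //.
      by apply/((GA i).2 y sy y0).
    by apply/((GA i).2 y sy y0).
move=> _ [x [B [xI mB ->]]]; exists [set y | B (y x - y 0)].
  apply: sub_sigma_algebra; exists [:: x]; first by move=> z; rewrite inE => /eqP->.
  by apply: sub_sigma_algebra; exists x, B; rewrite inE eqxx.
by move=> y sy y0 /=; rewrite y0 subr0; split => // -[].
Qed.

Lemma dominated_sample_space E :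
  (forall e w, sample_space (drifted W c D h e w)) ->
  (forall e w, drifted W c D h e w 0 = 0) ->
  <<s @sample_space R, @cylinders R >> E -> dom E.
Proof.
move=> sY Y0 /sample_space_sigma_algebra[A /dominated_finitely_determined dA EA].
have eq e : drifted W c D h e @^-1` E = drifted W c D h e @^-1` A.
  by apply/seteqP; split => w /=; rewrite EA.
by case: dA => A0 A1 A2 lA; split; rewrite !eq.
Qed.

End path_space.

(** * Primitives of nondecreasing functions *)

Section primitive.
Context {R : realType}.
Local Notation mu := (@lebesgue_measure R).
Implicit Types (f g : R -> R) (a b x m : R).

Lemma nondecreasing_11_bounds f x : nondecreasing_11 f -> x \in `[-1, 1]%R ->
  f (-1) <= f x <= f 1.
Proof.
move=> ndf xI; have := xI; rewrite in_itv/= => /andP[x1 x2].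
by rewrite !ndf// ?in_itv/= ?lexx// ?(le_trans x1).
Qed.

Lemma nondecreasing_11_measurable f : nondecreasing_11 f ->
  measurable_fun (`[-1, 1] : set R) f.
Proof.
(* Extend [f] by constants, to a nondecreasing function on the whole line. *)
move=> ndf; pose g x := f (Num.max (-1) (Num.min x 1)).
have cl x : Num.max (-1) (Num.min x 1) \in `[-1, 1]%R.
  by rewrite in_itv/= le_max lexx/= ge_max ge_min lexx orbT andbT; lra.
apply: (eq_measurable_fun g).
  move=> x; rewrite inE/= in_itv/= => /andP[x1 x2].
  by rewrite /g min_l// max_r.
apply: nondecreasing_measurable => // x y xy; apply: ndf => //.
by rewrite ge_max !le_max lexx/= le_min !ge_min lexx xy orbT/= orbT.
Qed.

Lemma lebesgue_measure_segment_fin a b : (mu `[a, b]%classic < +oo)%E.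
Proof. by rewrite lebesgue_measure_itv/=; case: ifP => _; rewrite ltry. Qed.

Lemma nondecreasing_11_integrable f : nondecreasing_11 f ->
  mu.-integrable `[-1, 1] (EFin \o f).
Proof.
move=> ndf; apply: measurable_bounded_integrable => //.
- exact: lebesgue_measure_segment_fin.
- exact: nondecreasing_11_measurable.
- exists (`|f (-1)| + `|f 1|); split; first by rewrite num_real.
  move=> N hN x /= xI; apply: le_trans (ltW hN).
  have /andP[] := nondecreasing_11_bounds ndf xI.
  have := ler_norm (f 1); have := ler_norm (- f (-1)); rewrite normrN.
  by rewrite ler_norml; have := normr_ge0 (f 1); have := normr_ge0 (f (-1)); lra.
Qed.

Lemma nondecreasing_11_square_integrable f : nondecreasing_11 f ->
  square_integrable_11 f.
Proof.
move=> ndf; split; first exact: nondecreasing_11_measurable.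
apply: measurable_bounded_integrable => //.
- exact: lebesgue_measure_segment_fin.
- by apply: measurable_funX; exact: nondecreasing_11_measurable.
- exists ((`|f (-1)| + `|f 1|) ^+ 2); split; first by rewrite num_real.
  move=> N hN x /= xI; apply: le_trans (ltW hN).
  have /andP[] := nondecreasing_11_bounds ndf xI.
  rewrite normrX ler_sqr ?nnegrE// ?addr_ge0//.
  have := ler_norm (f 1); have := ler_norm (- f (-1)); rewrite normrN.
  by rewrite ler_norml; have := normr_ge0 (f 1); have := normr_ge0 (f (-1)); lra.
Qed.

Section integrable.
Context (f : R -> R).
Hypothesis intf : mu.-integrable `[-1, 1] (EFin \o f).

Lemma integrable_sub11 a b : -1 <= a -> b <= 1 -> forall p q : bool,
  mu.-integrable [set` Interval (BSide p a) (BSide q b)] (EFin \o f).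
Proof.
move=> a1 b1 p q; apply: (integrableS _ _ _ intf) => //.
apply: subset_itvScc; first by case: p.
by case: q.
Qed.

Lemma Rintegral_chasles a b e : -1 <= a -> a <= b -> b <= e -> e <= 1 ->
  \int[mu]_(x in `[a, e]) f x =
  \int[mu]_(x in `[a, b]) f x + \int[mu]_(x in `[b, e]) f x.
Proof.
move=> a1 ab be e1; apply/eqP; rewrite addrC -subr_eq; apply/eqP.
rewrite Rintegral_itvB ?bnd_simp//; last exact: integrable_sub11.
rewrite Rintegral_itv_obnd_cbnd//; apply: integrable_sub11 => //; lra.
Qed.

Lemma primitive0_increment a b : -1 <= a -> a <= b -> b <= 1 ->
  primitive0 f b - primitive0 f a = \int[mu]_(x in `[a, b]) f x.
Proof.
move=> a1 ab b1; rewrite /primitive0.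
have n10 : -1 <= 0 :> R by lra.
have [a0|a0] := leP 0 a.
  by rewrite (le_trans a0 ab) (Rintegral_chasles n10 a0 ab b1); ring.
have [b0|b0] := leP 0 b.
  by rewrite opprK (Rintegral_chasles a1 (ltW a0) b0 b1); ring.
by rewrite (Rintegral_chasles a1 ab (ltW b0) ler01); ring.
Qed.

Lemma Rintegral_le_cst a b m : -1 <= a -> a <= b -> b <= 1 ->
  (forall x, x \in `[a, b]%R -> f x <= m) ->
  \int[mu]_(x in `[a, b]) f x <= m * (b - a).
Proof.
move=> a1 ab b1 fm.
have -> : m * (b - a) = \int[mu]_(x in `[a, b]) m.
  rewrite Rintegral_cst//= lebesgue_measure_itv/= lte_fin.
  by case: ltP => //= ba; rewrite (_ : b = a) ?subrr//; apply/eqP; rewrite eq_le ba.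
apply: le_Rintegral => //; first exact: integrable_sub11.
apply: measurable_bounded_integrable => //.
  exact: lebesgue_measure_segment_fin.
exact: bounded_cst.
Qed.

End integrable.

Lemma primitive0_increment_le f a b : nondecreasing_11 f ->
  -1 <= a -> a <= b -> b <= 1 -> primitive0 f b - primitive0 f a <= f b * (b - a).
Proof.
move=> ndf a1 ab b1; have intf := nondecreasing_11_integrable ndf.
rewrite primitive0_increment//; apply: Rintegral_le_cst => // x.
rewrite in_itv/= => /andP[ax xb].
by apply: ndf => //; rewrite in_itv/=; apply/andP; split; lra.
Qed.

Lemma primitive0_increment_ge f a b : nondecreasing_11 f ->
  -1 <= a -> a <= b -> b <= 1 -> f a * (b - a) <= primitive0 f b - primitive0 f a.
Proof.
move=> ndf a1 ab b1; have intf := nondecreasing_11_integrable ndf.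
rewrite primitive0_increment// -lerN2 -mulNr.
have intN : mu.-integrable `[-1, 1] (EFin \o (fun x => - f x)).
  rewrite (_ : _ \o _ = (\- (EFin \o f))%E); first exact: integrableN.
  by apply/funext => x /=; rewrite EFinN.
rewrite -[X in X <= _]mulN1r -RintegralZl//; last exact: integrable_sub11.
under eq_Rintegral do rewrite mulN1r.
apply: (Rintegral_le_cst intN) => // x.
rewrite in_itv/= => /andP[ax xb]; rewrite lerN2.
by apply: ndf => //; rewrite in_itv/=; apply/andP; split; lra.
Qed.

Lemma primitive0_continuous (f : R -> R) : nondecreasing_11 f ->
  {within `[-1, 1], continuous (primitive0 f)}.
Proof.
move=> ndf; pose B := `|f (-1)| + `|f 1| + 1.
have B0 : 0 < B by rewrite /B ltr_wpDl// addr_ge0.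
have fB x : x \in `[-1, 1]%R -> - B <= f x <= B.
  move=> xI; have /andP[] := nondecreasing_11_bounds ndf xI.
  have := ler_norm (f 1); have := ler_norm (- f (-1)); rewrite normrN /B.
  by have := normr_ge0 (f 1); have := normr_ge0 (f (-1)); lra.
have lip a b : a \in `[-1, 1]%R -> b \in `[-1, 1]%R -> a <= b ->
    `|primitive0 f b - primitive0 f a| <= B * (b - a).
  move=> aI bI ab; have /andP[fa1 fa2] := fB _ aI; have /andP[fb1 fb2] := fB _ bI.
  move: aI bI; rewrite !in_itv/= => /andP[a1 a2] /andP[b1 b2].
  rewrite ler_norml; apply/andP; split.
    apply: le_trans (primitive0_increment_ge ndf a1 ab b2).
    by rewrite -mulNr ler_wpM2r// subr_ge0.
  apply: (le_trans (primitive0_increment_le ndf a1 ab b2)).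
  by rewrite ler_wpM2r// subr_ge0.
apply/subspace_continuousP => x xI; apply/cvgrPdist_le => e e0.
rewrite near_withinE.
have : \forall t \near x, `|x - t| < e / B.
  by apply: (@cvgr_dist_lt _ _ _ (nbhs x) _ id x) => //; rewrite divr_gt0.
apply: filterS => t xt tI.
have xt' : B * `|x - t| <= e by rewrite mulrC -ler_pdivlMr// ltW.
apply: le_trans xt'; have [tx|/ltW xt'] := leP t x.
  by rewrite [X in _ <= _ * X]ger0_norm ?subr_ge0//; exact: lip.
rewrite distrC [X in _ <= _ * X]distrC [X in _ <= _ * X]ger0_norm ?subr_ge0//.
exact: lip.
Qed.

Lemma primitive00 (f : R -> R) : primitive0 f 0 = 0.
Proof.
by rewrite /primitive0 lexx set_itv1 Rintegral_set1.
Qed.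

(** The primitive of the indicator of [[l, l']], up to a constant. *)
Definition clamp (l l' x : R) : R := Num.max l (Num.min x l').

Lemma clamp_increment (l l' a b : R) : l <= l' -> a < b ->
  0 <= clamp l l' b - clamp l l' a <= b - a.
Proof.
rewrite /clamp => ll ab; apply/andP.
by case: (leP a l') => ?; case: (leP b l') => ?; case: (leP l a) => ?;
  case: (leP l b) => ?; case: (leP l l') => ?; split; lra.
Qed.

Lemma clamp_total (l l' a b : R) : l <= l' ->
  clamp l l' b - clamp l l' a <= l' - l.
Proof.
rewrite /clamp => ll.
by case: (leP a l') => ?; case: (leP b l') => ?; case: (leP l a) => ?;
  case: (leP l b) => ?; case: (leP l l') => ?; lra.
Qed.

Lemma Rintegral_bump (g : R -> R) (M l l' : R) a b :
  mu.-integrable `[-1, 1] (EFin \o g) -> l <= l' -> 0 <= M ->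
  (forall x, x \in `[-1, 1]%R -> x \in `[l, l']%R -> `|g x| <= M) ->
  (forall x, x \in `[-1, 1]%R -> x \notin `[l, l']%R -> g x = 0) ->
  -1 <= a -> a < b -> b <= 1 ->
  `|\int[mu]_(x in `[a, b]) g x| <= M * (clamp l l' b - clamp l l' a).
Proof.
move=> intg ll M0 gM g0 a1 ab b1.
have ig := integrable_sub11 intg a1 b1.
apply: (le_trans (le_normr_Rintegral _ _)) => //.
have ab11 x : x \in `[a, b]%R -> x \in `[-1, 1]%R.
  by rewrite !in_itv/= => /andP[? ?]; apply/andP; split; lra.
apply: (@le_trans _ _ (\int[mu]_(x in `[a, b]) (M * \1_`[l, l'] x))).
  apply: le_Rintegral => //.
  - by have := integrable_norm (ig true false).
  - have : mu.-integrable `[a, b] (EFin \o (fun x => M * \1_`[l, l'] x)) => //.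
    apply: measurable_bounded_integrable => //.
    + exact: lebesgue_measure_segment_fin.
    + by apply: measurable_funM => //; exact: measurable_indic.
    + exists M; split; first by rewrite num_real.
      move=> N MN x _ /=; apply: le_trans (ltW MN).
      rewrite normrM ger0_norm// ler_piMr// indicE.
      by case: (_ \in _); rewrite ?normr1 ?normr0.
  - move=> x /= xab; rewrite indicE mem_setE.
    case: (boolP (x \in `[l, l']%R)) => xl.
      by rewrite mulr1 gM// ab11.
    by rewrite g0 ?ab11// normr0 mulr0.
rewrite RintegralZl//; last first.
  apply: measurable_bounded_integrable => //.
  - exact: lebesgue_measure_segment_fin.
  - exists 1; split; first by rewrite num_real.
    move=> N MN x _ /=; apply: le_trans (ltW MN).
    by rewrite indicE; case: (_ \in _); rewrite ?normr1 ?normr0.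
apply: ler_wpM2l => //.
rewrite /Rintegral integral_indic//.
rewrite (_ : _ `&` _ = `[Num.max l a, Num.min l' b]%classic); last first.
  apply/seteqP; split => x /=; rewrite !in_itv/= ge_max le_min.
    by move=> [/andP[-> ->] /andP[-> ->]].
  by move=> /andP[/andP[-> ->] /andP[-> ->]].
rewrite /= lebesgue_measure_itv/= lte_fin.
have /andP[c0 _] := clamp_increment ll ab.
case: ifP => //=; rewrite gt_max !lt_min => /andP[/andP[_ lb] /andP[al' _]].
have lm : l <= Num.min b l' by rewrite le_min ll (ltW lb).
by rewrite /clamp (min_l (ltW al')) (max_r lm) minC.
Qed.

End primitive.

(** * The two-point lower bound *)

Section two_points.
Context d (T : measurableType d) (R : realType) (P : probability T R)
        (W : R -> {RV P >-> R}).
Hypothesis HW : two_sided_brownian W.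

Section shift.
Context (c : R) (D h u : R -> R) (M L eps : R).
Hypotheses (c0 : 0 < c) (M0 : 0 <= M) (eps0 : 0 < eps).
Hypothesis hu : forall a b, a \in `[-1, 1]%R -> b \in `[-1, 1]%R -> a < b ->
  `|h b - h a| <= M * (u b - u a).
Hypothesis u1 : forall a b, a < b -> 0 <= u b - u a <= b - a.
Hypothesis uL : forall a b, a < b -> u b - u a <= L.
Hypothesis sample : forall e w, sample_space (drifted W c D h e w).
Hypothesis start0 : forall e w, drifted W c D h e w 0 = 0.
Hypothesis small : expR (M ^+ 2 * L / c ^+ 2) - 1 <= eps ^+ 2.

(** Use the domination with [s = 1 + eps] on [E] and [s = 1] on its complement;
    the law with [e = 2] is eliminated by adding the two inequalities. *)
Lemma shifted_law_le E : <<s @sample_space R, @cylinders R >> E ->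
  [/\ measurable (drifted W c D h 0 @^-1` E),
      measurable (drifted W c D h 1 @^-1` E) &
      (P (drifted W c D h 1 @^-1` E) <= P (drifted W c D h 0 @^-1` E) + eps%:E)%E].
Proof.
move=> sE; have smallK := small; set K := expR _ in smallK.
have sC : <<s @sample_space R, @cylinders R >> (@sample_space R `\` E).
  exact: sigma_algebraCD.
have s1 : 0 < 1 + eps by rewrite addr_gt0.
have [m0 m1 m2 lE] := dominated_sample_space HW c0 M0 hu u1 uL s1 sample start0 sE.
have [_ _ _ lC] := dominated_sample_space HW c0 M0 hu u1 uL ltr01 sample start0 sC.
split => //.
have eC e : drifted W c D h e @^-1` (@sample_space R `\` E) =
    ~` (drifted W c D h e @^-1` E).
  by apply/seteqP; split => w /=; [case|split].
move: lC; rewrite !eC !probability_setC//.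
move: lE; rewrite -/K.
have f0 := fin_num_measure P _ m0; have f1 := fin_num_measure P _ m1.
have f2 := fin_num_measure P _ m2.
rewrite -(fineK f0) -(fineK f1) -(fineK f2).
set q1 := fine _; set q0 := fine _; set q2 := fine _.
rewrite -!EFinB -!EFinM -!EFinD !lee_fin divr1 mul1r => lE lC.
have q00 : 0 <= q0 by rewrite fine_ge0.
have q01 : q0 <= 1 by rewrite -lee_fin fineK// probability_le1.
have lE' : 2 * (1 + eps) * q1 <= (1 + eps) ^+ 2 * q0 + K * q2.
  have : (1 + eps) * (2 * q1) <= (1 + eps) * ((1 + eps) * q0 + K / (1 + eps) * q2).
    by apply: ler_wpM2l lE; exact: (ltW s1).
  rewrite (_ : (1 + eps) * ((1 + eps) * q0 + K / (1 + eps) * q2) =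
    (1 + eps) ^+ 2 * q0 + K * q2); first by rewrite mulrA [_ * 2]mulrC.
  by field; rewrite gt_eqF.
have : 2 * eps * q1 <= 2 * eps * (q0 + eps).
  have e2 : eps ^+ 2 * q0 <= eps ^+ 2 by rewrite ler_piMr// sqr_ge0.
  rewrite expr2 in e2 lE' smallK.
  nra.
by rewrite ler_pM2l// mulr_gt0.
Qed.

End shift.

Lemma sample_space_lin (D h : R -> R) (c e : R) (y : R -> R) :
  sample_space D -> sample_space h -> sample_space y ->
  sample_space (fun t => D t + e * h t + c * y t).
Proof.
move=> /subspace_continuousP cD /subspace_continuousP ch /subspace_continuousP cy.
apply/subspace_continuousP => x xI.
apply: cvgD; first (apply: cvgD; first exact: cD).
  by apply: cvgM; [exact: cvg_cst|exact: ch].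
by apply: cvgM; [exact: cvg_cst|exact: cy].
Qed.

Lemma brownian_sample w : sample_space (fun t => W t w).
Proof. by apply: continuous_subspaceT; exact: (brownian_continuous HW). Qed.

Lemma observation_sample n f w : nondecreasing_11 f ->
  sample_space (observation W n f w).
Proof.
move=> ndf; have := @sample_space_lin _ _ (Num.sqrt n%:R)^-1 0 _
  (primitive0_continuous ndf) (primitive0_continuous ndf) (@brownian_sample w).
by congr sample_space; apply/funext => t; rewrite mul0r addr0.
Qed.

(** If [r] is at most half of the distance between the two values at 0, an error less
    than [r] under one hypothesis is an error more than [r] under the other, so the
    two error probabilities add up to at least [1 - eps]. *)
Lemma minimax_lower_bound (n : nat) (f0 f1 : R -> R) (theta : (R -> R) -> R)
    (r M l l' eps : R) : (0 < n)%N ->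
  nondecreasing_11 f0 -> nondecreasing_11 f1 -> estimator theta ->
  2 * r <= `|f1 0 - f0 0| -> l <= l' -> 0 <= M -> 0 < eps ->
  (forall x, x \in `[-1, 1]%R -> x \in `[l, l']%R -> `|f1 x - f0 x| <= M) ->
  (forall x, x \in `[-1, 1]%R -> x \notin `[l, l']%R -> f1 x - f0 x = 0) ->
  expR (M ^+ 2 * (l' - l) * n%:R) - 1 <= eps ^+ 2 ->
  (((1 - eps) / 2)%:E <=
   maxe (error_prob W n theta f0 r) (error_prob W n theta f1 r))%E.
Proof.
move=> n0 nd0 nd1 th r2 ll M0 eps0 fM f00 small.
pose c : R := (Num.sqrt n%:R)^-1.
have c0 : 0 < c by rewrite invr_gt0 sqrtr_gt0 ltr0n.
have c2 : c ^+ 2 = n%:R^-1 by rewrite exprVn sqr_sqrtr.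
pose D := primitive0 f0; pose h t := primitive0 f1 t - primitive0 f0 t.
have sh : sample_space h.
  have := @sample_space_lin _ _ 0 (-1) _ (primitive0_continuous nd1)
    (primitive0_continuous nd0) (primitive0_continuous nd0).
  by congr sample_space; apply/funext => t; rewrite /h mul0r addr0 mulN1r.
have sample e w : sample_space (drifted W c D h e w).
  exact: sample_space_lin (primitive0_continuous nd0) sh (@brownian_sample w).
have start0 e w : drifted W c D h e w 0 = 0.
  by rewrite /drifted /D /h !primitive00 (brownian0 HW) subrr !mulr0 !addr0.
have hu a b : a \in `[-1, 1]%R -> b \in `[-1, 1]%R -> a < b ->
    `|h b - h a| <= M * (clamp l l' b - clamp l l' a).
  rewrite !in_itv/= => /andP[a1 a2] /andP[b1 b2] ab.
  have i0 := nondecreasing_11_integrable nd0.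
  have i1 := nondecreasing_11_integrable nd1.
  have -> : h b - h a = (primitive0 f1 b - primitive0 f1 a) -
      (primitive0 f0 b - primitive0 f0 a) by rewrite /h; ring.
  rewrite !primitive0_increment ?(ltW ab)//.
  rewrite -RintegralB//; [|exact: integrable_sub11..].
  apply: Rintegral_bump => //.
  rewrite (_ : _ \o _ = ((EFin \o f1) \- (EFin \o f0))%E); first by apply: integrableB.
  by apply/funext => x /=; rewrite EFinB.
have small' : expR (M ^+ 2 * (l' - l) / c ^+ 2) - 1 <= eps ^+ 2.
  by rewrite c2 invrK.
have mB z : measurable [set x : R | r <= `|x - z|].
  by apply: measurable_norm_ge; exact: measurable_funB.
have le10 := shifted_law_le c0 M0 eps0 hu
  (fun a b => @clamp_increment _ l l' a b ll)
  (fun a b _ => @clamp_total _ l l' a b ll) sample start0 small' (th _ (mB _)).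
have [mA0 mA1 leA] := le10 (f0 0); have [_ mB1 _] := le10 (f1 0).
rewrite /= in mA0 mA1 leA mB1.
have obs0 w : observation W n f0 w = drifted W c D h 0 w.
  by apply/funext => t; rewrite /drifted mul0r addr0.
have obs1 w : observation W n f1 w = drifted W c D h 1 w.
  by apply/funext => t; rewrite /observation /drifted /D /h mul1r subrKC.
have e0E : error_prob W n theta f0 r = P (drifted W c D h 0 @^-1`
    [set y | sample_space y /\ r <= `|theta y - f0 0|]).
  rewrite /error_prob /law; congr (P _); apply/seteqP.
  by split => w /=; rewrite obs0 // => -[].
have e1E : (P (~` (drifted W c D h 1 @^-1`
    [set y | sample_space y /\ (r <= `|theta y - f0 0|)%R])) <=
    error_prob W n theta f1 r)%E.
  rewrite (_ : error_prob W n theta f1 r = P (drifted W c D h 1 @^-1`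
    [set y | sample_space y /\ r <= `|theta y - f1 0|])); last first.
    rewrite /error_prob /law; congr (P _); apply/seteqP.
    by split => w /=; rewrite obs1 // => -[].
  apply: le_measure; rewrite ?inE//; first exact: measurableC.
  move=> w /= nA; split; first exact: sample.
  have {}nA : `|theta (drifted W c D h 1 w) - f0 0| < r.
    by rewrite ltNge; apply/negP => rA; apply: nA.
  have := ler_distD (theta (drifted W c D h 1 w)) (f1 0) (f0 0).
  by rewrite [`|f1 0 - theta _|]distrC; lra.
rewrite probability_setC// in e1E.
rewrite -e0E in leA.
have f0' : error_prob W n theta f0 r \is a fin_num.
  by rewrite e0E; exact: fin_num_measure.
move: leA e1E; set q1 := P _ => leA e1E.
have f1' : q1 \is a fin_num by exact: fin_num_measure.
move: leA e1E; rewrite -(fineK f0') -(fineK f1') -EFinB -EFinD lee_fin.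
set q0 := fine (error_prob _ _ _ _ _) => q10 q1e.
have [h0|h0] := leP ((1 - eps) / 2) q0.
  by rewrite le_max lee_fin h0.
rewrite le_max; apply/orP; right; apply: le_trans q1e; rewrite lee_fin; lra.
Qed.

End two_points.

(** * A modulus of continuity of Brownian motion around a fixed time *)

Section chaining.
Context {R : realType}.
Local Notation rho := (9 / 10 : R).

(** Go from a dyadic point to its left neighbour in the coarser grid.  The bounds
    [c rho^j] on the successive steps add up to [10 c (1 - rho^(j+1))], because
    [1 / (1 - rho) = 10]. *)
Lemma chaining_dyadic (b : R -> R) (L c : R) : b 0 = 0 ->
  (forall j k, (k < 2 ^ j)%N ->
    `|b (L * k.+1%:R / 2 ^+ j) - b (L * k%:R / 2 ^+ j)| <= c * rho ^+ j) ->
  forall j k, (k <= 2 ^ j)%N ->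
    `|b (L * k%:R / 2 ^+ j)| <= 10 * c * (1 - rho ^+ j.+1).
Proof.
move=> b0 bc; have c0 : 0 <= c.
  by have := bc 0%N 0%N isT; rewrite !expr0 mulr1; apply: le_trans; exact: normr_ge0.
elim=> [|j IH] k kj.
  have := bc 0%N 0%N isT; rewrite !expr0 !divr1 !mulr1 mulr0 b0 subr0 expr1.
  move: kj; rewrite expn0; case: k => [_ _|[_|//]].
    by rewrite mulr0 b0 normr0; lra.
  by rewrite mulr1; lra.
have even i : (i <= 2 ^ j)%N ->
    `|b (L * (i.*2)%:R / 2 ^+ j.+1)| <= 10 * c * (1 - rho ^+ j.+1).
  move=> ij; rewrite (_ : L * _ / _ = L * i%:R / 2 ^+ j); first exact: IH.
  by rewrite -muln2 natrM exprS; field; rewrite expf_neq0.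
have rS : 10 * c * (1 - rho ^+ j.+2) = 10 * c * (1 - rho ^+ j.+1) + c * rho ^+ j.+1.
  by rewrite [rho ^+ j.+2]exprS; field.
have r0 : 0 <= c * rho ^+ j.+1 by rewrite mulr_ge0// exprn_ge0//; lra.
rewrite rS -[k]odd_double_half; case: (boolP (odd k)) => ok; rewrite ?add1n ?add0n.
  have hj : (k./2 < 2 ^ j)%N.
    have : (k./2.*2 < (2 ^ j).*2)%N.
      rewrite -[in X in (_ < X)%N]mul2n -expnS; apply: leq_trans kj.
      by rewrite -[X in (_ < X)%N]odd_double_half ok.
    by rewrite ltn_double.
  have hk : (k./2.*2 < 2 ^ j.+1)%N by rewrite expnS mul2n ltn_double.
  have := bc j.+1 _ hk; have := even _ (ltnW hj).
  set x := b _; set y := b _ => xe yx.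
  rewrite -[y](subrK x); apply: (le_trans (ler_normD _ _)); lra.
have /even : (k./2 <= 2 ^ j)%N.
  rewrite -leq_double -[in X in (_ <= X)%N]mul2n -expnS; apply: leq_trans kj.
  by rewrite -[X in (_ <= X)%N]odd_double_half leq_addl.
lra.
Qed.

(** [rho = 9/10] is a compromise: [rho < 1] makes the steps summable, and
    [2 rho^4 > 1] makes the exceptional probabilities summable in
    [brownian_modulus]. *)
Lemma chaining (b : R -> R) (L c : R) : continuous b -> b 0 = 0 -> 0 < L ->
  (forall j k, (k < 2 ^ j)%N ->
    `|b (L * k.+1%:R / 2 ^+ j) - b (L * k%:R / 2 ^+ j)| <= c * rho ^+ j) ->
  forall u, 0 <= u <= L -> `|b u| <= 10 * c.
Proof.
move=> cb b0 L0 bc u /andP[u0 uL].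
have c0 : 0 <= c.
  by have := bc 0%N 0%N isT; rewrite !expr0 mulr1; apply: le_trans; exact: normr_ge0.
rewrite leNgt; apply/negP => bu.
have /cvgr_gt/(_ _ bu)[e /= e0 he] : `|b t| @[t --> u] --> `|b u|.
  by apply: cvg_norm; exact: cb.
have [j jL] : exists j, L / e < 2 ^+ j.
  exists (Num.bound (L / e)); apply: lt_trans (archi_boundP _) _.
    by rewrite divr_ge0 ?ltW.
  by rewrite -natrX ltr_nat ltn_expl.
have p0 : 0 < (2 : R) ^+ j by rewrite exprn_gt0.
pose k := Num.truncn (u * 2 ^+ j / L).
have v0 : 0 <= u * 2 ^+ j / L by rewrite divr_ge0 ?mulr_ge0// ltW.
have /andP[k1 k2] := truncn_itv v0.
have kj : (k <= 2 ^ j)%N.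
  rewrite -(ler_nat R) natrX; apply: (le_trans k1).
  by rewrite ler_pdivrMr// mulrC ler_wpM2l// ltW.
have := chaining_dyadic b0 bc kj.
have : 10 * c < `|b (L * k%:R / 2 ^+ j)|.
  apply: he; rewrite /ball/=.
  move: k1 k2; rewrite -/k ler_pdivlMr// ltr_pdivrMr// -addn1 natrD => k1 k2.
  move: jL; rewrite ltr_pdivrMr// => jL.
  rewrite ger0_norm; last by rewrite subr_ge0 ler_pdivrMr// mulrC.
  by rewrite ltrBlDr -ltrBlDl ltr_pdivlMr//; nra.
have : 0 <= c * rho ^+ j.+1 by rewrite mulr_ge0// exprn_ge0//; lra.
lra.
Qed.

End chaining.

Section union_bounds.
Context d (T : measurableType d) (R : realType) (P : probability T R).
Implicit Types (A : nat -> set T) (C q : R).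

Lemma geometric_union_bound A C q : (forall i, measurable (A i)) ->
  0 <= C -> 0 <= q < 1 -> (forall i, (P (A i) <= (C * q ^+ i)%:E)%E) ->
  (P (\bigcup_i A i) <= (C / (1 - q))%:E)%E.
Proof.
move=> mA C0 /andP[q0 q1] PA.
have q1' : 0 < 1 - q by rewrite subr_gt0.
apply: (le_trans (generalized_Boole_inequality _ mA _)).
  exact: bigcupT_measurable.
apply: lime_le; first exact: is_cvg_nneseries.
apply: nearW => n; apply: (@le_trans _ _ (\sum_(0 <= i < n) (C * q ^+ i)%:E)%E).
  by apply: lee_sum => i _; exact: PA.
rewrite sumEFin lee_fin.
have -> : \sum_(0 <= i < n) C * q ^+ i = C / (1 - q) * (1 - q ^+ n).
  elim: n => [|n IH]; first by rewrite big_geq// expr0 subrr mulr0.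
  by rewrite big_nat_recr//= IH exprS; field; rewrite gt_eqF.
by rewrite ler_piMr ?divr_ge0 ?(ltW q1')// gerBl exprn_ge0.
Qed.

Lemma finite_union_bound A n C : (forall i, measurable (A i)) ->
  (forall i, (P (A i) <= C%:E)%E) ->
  (P (\bigcup_(i < n) A i) <= (n%:R * C)%:E)%E.
Proof.
move=> mA PA; rewrite bigcup_mkord.
apply: (le_trans (Boole_inequality _ _)) => //.
apply: (@le_trans _ _ (\sum_(i < n) C%:E)%E); first by apply: lee_sum => i _; exact: PA.
by rewrite sumEFin lee_fin sumr_const card_ord mulr_natl.
Qed.

End union_bounds.

Section modulus.
Context d (T : measurableType d) (R : realType) (P : probability T R)
        (W : R -> {RV P >-> R}).
Hypothesis HW : two_sided_brownian W.

Lemma measurable_increment_ge (s t x : R) :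
  measurable [set w | x <= `|W t w - W s w|].
Proof.
by apply: measurable_norm_ge; exact: measurable_funB.
Qed.

Lemma increment_tail (s t x : R) : 0 < x -> s != t ->
  (P [set w | (x <= `|W t w - W s w|)%R] <= (64 * (t - s) ^+ 2 / x ^+ 4)%:E)%E.
Proof.
move=> x0; wlog st : s t / s < t.
  move=> H; rewrite neq_lt => /orP[st|ts]; first by apply: H => //; rewrite lt_eqF.
  rewrite -[(t - s) ^+ 2]sqrrN opprB.
  under eq_set => w do rewrite distrC.
  by apply: H => //; rewrite lt_eqF.
move=> _; have mB : measurable [set y : R | x <= `|y|].
  by apply: measurable_norm_ge; exact: measurable_id.
have ts0 : 0 < t - s by rewrite subr_gt0.
have := brownian_normal HW st mB => /= ->.
apply: (le_trans (normal_prob_tail _ x0)); first by rewrite sqrtr_gt0.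
by rewrite lee_fin (_ : 4%N = (2 * 2)%N)// [Num.sqrt _ ^+ _]exprM sqr_sqrtr// ltW.
Qed.

(** The windows [[0, L i]], with [L i = 2^(i+1) delta], cover all [u].  On the
    [i]-th one, chain with thresholds of order [C 2^i (delta)^(1/2)], that is,
    [C 2^(i/2)] standard deviations.  A fourth-order tail and a union over the
    [2^j] increments of level [j] leave a probability of order
    [C^-4 4^-i (1 / (2 rho^4))^j], which can be summed over [i] and [j]
    independently of [delta]. *)
Lemma brownian_modulus (eps : R) : 0 < eps -> exists2 C : R, 0 < C &
  forall (delta tau e : R), 0 < delta -> `|e| = 1 ->
  exists E : set T, [/\ measurable E, (P E <= eps%:E)%E &
    forall w, ~ E w -> forall u, delta <= u ->
      `|W (tau + e * u) w - W tau w| <= C * u / Num.sqrt delta].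
Proof.
move=> eps0; pose q : R := (10 / 9) ^+ 4 / 2.
have q01 : 0 <= q < 1 by rewrite /q; lra.
have q1 : 0 < 1 - q by lra.
pose K : R := 64 * (4 * 10 ^+ 4) / (1 - q) / (1 - 1 / 4).
have K0 : 0 < K.
  apply: divr_gt0; last lra.
  by apply: divr_gt0 q1; rewrite !mulr_gt0// exprn_gt0.
pose C : R := 1 + K / eps.
have C1 : 1 <= C by rewrite /C lerDl divr_ge0// ltW.
have C0 : 0 < C by exact: lt_le_trans C1.
have KC : K / C ^+ 4 <= eps.
  rewrite ler_pdivrMr ?exprn_gt0//.
  have : C <= C ^+ 4 by rewrite -[leLHS]expr1 ler_weXn2l.
  have : K = eps * (C - 1) by rewrite /C; field; rewrite gt_eqF.
  nra.
exists C => // delta tau e delta0 e1.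
have sd0 : 0 < Num.sqrt delta by rewrite sqrtr_gt0.
have sdE : Num.sqrt delta ^+ 2 = delta by rewrite sqr_sqrtr// ltW.
pose L i : R := 2 ^+ i.+1 * delta.
pose c i : R := C * 2 ^+ i * Num.sqrt delta / 10.
have L0 i : 0 < L i by rewrite mulr_gt0// exprn_gt0.
have c0 i : 0 < c i by rewrite divr_gt0// !mulr_gt0// exprn_gt0.
pose pt i j k : R := tau + e * (L i * k%:R / 2 ^+ j).
pose B i j k := [set w | c i * (9 / 10) ^+ j <= `|W (pt i j k.+1) w - W (pt i j k) w|].
have mB i j k : measurable (B i j k) by exact: measurable_increment_ge.
pose E i := \bigcup_j \bigcup_(k < (2 ^ j)%N) B i j k.
have mE' i j : measurable (\bigcup_(k < (2 ^ j)%N) B i j k).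
  by apply: fin_bigcup_measurable => // k _.
have mE i : measurable (E i) by exact: bigcupT_measurable.
have PB i j k : (P (B i j k) <=
    (64 * (L i / 2 ^+ j) ^+ 2 / (c i * (9 / 10) ^+ j) ^+ 4)%:E)%E.
  have x0 : 0 < c i * (9 / 10) ^+ j by rewrite mulr_gt0// exprn_gt0//; lra.
  have ee : e ^+ 2 = 1 by rewrite -[e ^+ 2]ger0_norm ?sqr_ge0// normrX e1 expr1n.
  have pd : pt i j k.+1 - pt i j k = e * (L i / 2 ^+ j).
    by rewrite /pt -addn1 natrD; ring.
  have := @increment_tail (pt i j k) (pt i j k.+1) _ x0.
  rewrite pd [(e * _) ^+ 2]exprMn ee mul1r; apply.
  rewrite eq_sym -subr_eq0 pd; apply: mulf_neq0; first by rewrite -normr_gt0 e1.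
  by rewrite gt_eqF// divr_gt0// exprn_gt0.
have PEij i j : (P (\bigcup_(k < (2 ^ j)%N) B i j k) <=
    (64 * L i ^+ 2 / c i ^+ 4 * q ^+ j)%:E)%E.
  apply: (le_trans (finite_union_bound _ (mB i j) (PB i j))).
  rewrite lee_fin natrX le_eqVlt; apply/orP; left; apply/eqP.
  have -> : q ^+ j = 2 ^+ j / (2 ^+ j) ^+ 2 / ((9 / 10) ^+ j) ^+ 4.
    rewrite -!exprM ![(j * _)%N]mulnC !exprM -!exprVn -!exprMn.
    by congr (_ ^+ _); rewrite /q; field.
  have t0 : (2 : R) ^+ j != 0 by rewrite expf_neq0.
  have r0 : (9 / 10 : R) ^+ j != 0 by rewrite expf_neq0//; lra.
  move: t0 r0; set x := _ ^+ j; set y := (9 / 10) ^+ j => t0 r0.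
  by field; rewrite t0 r0 gt_eqF.
have PE i : (P (E i) <= (64 * (4 * 10 ^+ 4) / (1 - q) / C ^+ 4 * (1 / 4) ^+ i)%:E)%E.
  have h0 : 0 <= 64 * L i ^+ 2 / c i ^+ 4.
    by rewrite divr_ge0 ?mulr_ge0 ?exprn_ge0// ltW.
  apply: (le_trans (geometric_union_bound (mE' i) h0 q01 (PEij i))).
  rewrite lee_fin le_eqVlt; apply/orP; left; apply/eqP.
  have -> : (1 / 4 : R) ^+ i = (2 ^+ i) ^+ 2 / (2 ^+ i) ^+ 4.
    rewrite -!exprM ![(i * _)%N]mulnC !exprM -!exprVn -!exprMn.
    by congr (_ ^+ _); field.
  have t0 : (2 : R) ^+ i != 0 by rewrite expf_neq0.
  rewrite /L /c [2 ^+ i.+1]exprS -[X in 2 * _ * X]sdE.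
  move: t0; set x := _ ^+ i => t0.
  by field; rewrite t0 !gt_eqF.
exists (\bigcup_i E i); split; first exact: bigcupT_measurable.
  have h0 : 0 <= 64 * (4 * 10 ^+ 4) / (1 - q) / C ^+ 4.
    by rewrite !divr_ge0 ?mulr_ge0 ?exprn_ge0 ?(ltW C0) ?(ltW q1).
  have h4 : 0 <= (1 / 4 : R) < 1 by lra.
  apply: (le_trans (geometric_union_bound mE h0 h4 PE)).
  rewrite lee_fin; apply: le_trans KC; rewrite /K.
  by rewrite [X in X <= _]mulrAC.
move=> w nE u du.
pose b v := W (tau + e * v) w - W tau w.
have cb : continuous b.
  move=> v; apply: cvgB; last exact: cvg_cst.
  apply: (@continuous_comp _ _ _ (fun v => tau + e * v) (fun t => W t w)).
    by apply: cvgD; [exact: cvg_cst|apply: cvgM; [exact: cvg_cst|exact: cvg_id]].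
  exact: (brownian_continuous HW).
have b0 : b 0 = 0 by rewrite /b mulr0 addr0 subrr.
have exL : exists i, u <= L i.
  exists (Num.bound (u / delta)); rewrite /L -ler_pdivrMr//.
  apply: (le_trans (ltW (archi_boundP _))).
    by rewrite divr_ge0// ?(ltW delta0)// (le_trans (ltW delta0)).
  by rewrite -natrX ler_nat; apply/ltnW/(leq_trans (ltn_expl _ (leqnn 2)))/leq_pexp2l.
(* The smallest window containing [u]; by minimality, [2^i delta <= u]. *)
case: (ex_minnP exL) => i ui imin.
have iu : 2 ^+ i * delta <= u.
  case: i ui imin => [_ _|i _ imin]; first by rewrite expr0 mul1r.
  by rewrite leNgt; apply/negP => /ltW /imin; rewrite ltnn.
have bc j k : (k < 2 ^ j)%N -> `|b (L i * k.+1%:R / 2 ^+ j) -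
    b (L i * k%:R / 2 ^+ j)| <= c i * (9 / 10) ^+ j.
  move=> kj; rewrite leNgt; apply/negP => /ltW bad; apply: nE.
  exists i => //; exists j => //; exists k => //.
  by rewrite /B/= /pt; move: bad; rewrite /b opprB addrA subrK.
have u0 : 0 <= u by rewrite (le_trans (ltW delta0)).
have := chaining cb b0 (L0 i) bc.
move=> /(_ u); rewrite u0 ui => /(_ isT) bu; apply: (le_trans bu).
rewrite ler_pdivlMr// (_ : 10 * c i * _ = C * (2 ^+ i * delta)).
  by rewrite ler_pM2l.
by rewrite /c -[X in _ = C * (_ * X)]sdE; field.
Qed.

End modulus.

(** * The left derivative of the greatest convex minorant *)

Section convex_minorant.
Context {R : realType}.
Implicit Types (a b s t m M h k : R) (y : R -> R).

Definition minorant y a b := forall s, s \in `[-1, 1]%R -> a * s + b <= y s.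

Section path.
Context (y : R -> R).
Hypothesis sy : sample_space y.

Lemma sample_space_bounded :
  exists B, forall s, s \in `[-1, 1]%R -> - B <= y s <= B.
Proof.
have n11 : (-1 : R) <= 1 by lra.
have [u _ yu] := EVT_max n11 sy; have [v _ yv] := EVT_min n11 sy.
exists (`|y u| + `|y v|) => s sI.
have := yu s sI; have := yv s sI.
have := ler_norm (y u); have := ler_norm (- y v); rewrite normrN.
by have := normr_ge0 (y u); have := normr_ge0 (y v); move=> *; apply/andP; split; lra.
Qed.

Lemma le_gcm t a b : t \in `[-1, 1]%R -> minorant y a b -> a * t + b <= gcm y t.
Proof.
move=> tI ab; apply: ub_le_sup; last by exists a, b.
by exists (y t) => _ [a' [b' [ab' ->]]]; exact: ab'.
Qed.

Lemma gcm_le t m : (forall a b, minorant y a b -> a * t + b <= m) ->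
  gcm y t <= m.
Proof.
move=> h; apply: ge_sup; last by move=> _ [a [b [ab ->]]]; exact: h.
have [B yB] := sample_space_bounded.
exists (0 * t - B), 0, (- B); split => // s sI.
by rewrite mul0r add0r; have /andP[] := yB s sI.
Qed.

Let I0 : (0 : R) \in `[-1, 1]%R. Proof. by rewrite in_itv/=; lra. Qed.

(** An affine minorant [a * s + b] with [a > M] may be rotated around its value at 0
    to have slope [M]: this lowers it on the right, and on the left the rotated
    line lies below the line of slope [M] through [(d, y d)], hence below [y].
    All minorants therefore lose at most [M * h] from 0 to [- h]. *)
Lemma gcm_slope_le d M : 0 < d <= 1 ->
  (forall s, -1 <= s <= 0 -> y d - y s <= M * (d - s)) ->
  forall h, 0 < h <= 1 -> gcm y 0 - gcm y (0 - h) <= M * h.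
Proof.
move=> /andP[d0 d1] yM h /andP[h0 h1]; rewrite lerBlDr; apply: gcm_le => a b ab.
have hI : 0 - h \in `[-1, 1]%R by rewrite in_itv/=; lra.
have [aM|Ma] := leP a M.
  by have := le_gcm hI ab; nra.
suff /(le_gcm hI) : minorant y M b by lra.
move=> s sI; have := sI; rewrite in_itv/= => /andP[s1 s2].
have [s0|s0] := leP 0 s; first by have := ab s sI; nra.
have /ab : d \in `[-1, 1]%R by rewrite in_itv/=; lra.
have : y d - y s <= M * (d - s) by apply: yM; rewrite s1 ltW.
by nra.
Qed.

(** As for [gcm_slope_le], now rotating a minorant around its value at [- h].  The
    rotated line might exceed [y] between [- h] and 0; there the hypothesis says
    nothing, but by continuity at 0 it persists with the smaller slope [m'],
    provided that [h] is small. *)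
Lemma gcm_slope_ge d m m' : 0 < d <= 1 -> m' < m ->
  (forall t, 0 <= t <= 1 -> m * (t + d) <= y t - y (- d)) ->
  \forall h \near 0^'+, m' * h <= gcm y 0 - gcm y (0 - h).
Proof.
move=> /andP[d0 d1] mm' ym.
have [e e0 ye] : exists2 e, 0 < e &
    forall t, - e < t < 0 -> m' * (t + d) <= y t - y (- d).
  have c0 : {for 0, continuous y}.
    by apply: (within_continuous_continuous _ sy); rewrite ?in_itv/=; lra.
  have cy : (fun t => y t - m' * (t + d)) @ (0 : R) --> y 0 - m' * (0 + d).
    apply: cvgB => //; apply: cvgM; first exact: cvg_cst.
    by apply: cvgD; [exact: cvg_id|exact: cvg_cst].
  have lt0 : y (- d) < y 0 - m' * (0 + d).
    have : m * (0 + d) <= y 0 - y (- d) by apply: ym; rewrite lexx ler01.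
    by nra.
  have [e /= e0 he] : \forall t \near (0 : R), y (- d) < y t - m' * (t + d).
    by have/cvgr_gt := cy; apply.
  exists e => // t /andP[t1 t2].
  have : ball (0 : R) e t by rewrite /ball/= sub0r normrN ltr_norml; lra.
  by move=> /he; lra.
near=> h.
have h0 : 0 < h by near: h; exact: nbhs_right_gt.
have he : h < e by near: h; exact: nbhs_right_lt.
have hd : h < d by near: h; exact: nbhs_right_lt.
have hI : 0 - h \in `[-1, 1]%R by rewrite in_itv/=; lra.
rewrite lerBrDr addrC -lerBrDr; apply: gcm_le => a b ab; rewrite lerBrDr.
have [ma|am] := leP m' a; first by have := le_gcm I0 ab; nra.
suff /(le_gcm I0) : minorant y m' (a * (0 - h) + b + m' * h) by lra.
move=> s sI; have := sI; rewrite in_itv/= => /andP[s1 s2].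
have [sh|hs] := leP s (- h); first by have := ab s sI; nra.
have /ab yd : - d \in `[-1, 1]%R by rewrite in_itv/=; lra.
have : m' * (s + d) <= y s - y (- d).
  have [s0|s0] := leP 0 s; last by apply: ye; lra.
  have : m * (s + d) <= y s - y (- d) by apply: ym; rewrite s0.
  by nra.
by nra.
Unshelve. all: by end_near. Qed.

(** Convexity of the minorant. *)
Lemma gcm_quotient_noninc h k : 0 < h -> h <= k -> k <= 1 ->
  (gcm y 0 - gcm y (0 - k)) / k <= (gcm y 0 - gcm y (0 - h)) / h.
Proof.
move=> h0 hk k1; have k0 : 0 < k by exact: lt_le_trans hk.
rewrite ler_pdivrMr// mulrAC ler_pdivlMr//.
have kI : 0 - k \in `[-1, 1]%R by rewrite in_itv/=; lra.
suff : k * gcm y (0 - h) <= (k - h) * gcm y 0 + h * gcm y (0 - k) by nra.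
rewrite mulrC -ler_pdivlMr//; apply: gcm_le => a b ab.
rewrite ler_pdivlMr//.
have g0 := le_gcm I0 ab; have gk := le_gcm kI ab.
have : (k - h) * (a * 0 + b) <= (k - h) * gcm y 0.
  by rewrite ler_wpM2l// subr_ge0.
have : h * (a * (0 - k) + b) <= h * gcm y (0 - k) by rewrite ler_wpM2l// ltW.
by nra.
Qed.

Lemma is_cvg_gcm_quotient :
  cvg ((gcm y 0 - gcm y (0 - h)) / h @[h --> 0^'+]).
Proof.
have [B yB] := sample_space_bounded.
have B0 : 0 <= B by have /andP[] := yB 0 I0; lra.
apply/cvg_ex; eexists; apply: (@nonincreasing_at_right_cvgr _ _ 0 (BRight 1)).
- by rewrite bnd_simp.
- move=> h k; rewrite !in_itv/= => /andP[h0 _] /andP[_ k1] hk.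
  exact: gcm_quotient_noninc.
exists (2 * B) => _ [h /= hI <-]; move: hI; rewrite in_itv/= => /andP[h0 h1].
rewrite ler_pdivrMr//; apply: (@gcm_slope_le 1); rewrite ?ltr01 ?lexx ?h0//.
move=> s /andP[s1 s0].
have /yB/andP[_ y1] : (1 : R) \in `[-1, 1]%R by rewrite in_itv/=; lra.
have /yB/andP[ys _] : s \in `[-1, 1]%R by rewrite in_itv/=; lra.
by nra.
Qed.

Lemma monotone_lse_le d M : 0 < d <= 1 ->
  (forall s, -1 <= s <= 0 -> y d - y s <= M * (d - s)) ->
  monotone_lse 0 y <= M.
Proof.
move=> d01 yM; apply: limr_le; first exact: is_cvg_gcm_quotient.
near=> h.
have h0 : 0 < h by near: h; exact: nbhs_right_gt.
rewrite ler_pdivrMr//; apply: gcm_slope_le yM _ _ => //.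
by rewrite h0; near: h; exact: nbhs_right_le.
Unshelve. all: by end_near. Qed.

Lemma monotone_lse_ge d m : 0 < d <= 1 ->
  (forall t, 0 <= t <= 1 -> m * (t + d) <= y t - y (- d)) ->
  m <= monotone_lse 0 y.
Proof.
move=> d01 ym; apply/ler_addgt0Pr => e e0; rewrite -lerBlDr.
have me : m - e < m by lra.
apply: limr_ge; first exact: is_cvg_gcm_quotient.
have := gcm_slope_ge d01 me ym; apply: filterS2 (nbhs_right_gt 0) => h h0.
by rewrite ler_pdivlMr.
Qed.

End path.
End convex_minorant.

Section measurable_lse.
Context {R : realType}.

(** By continuity, rational times suffice; together with [lt_gcm_rat] this makes
    events on the convex minorant countable combinations of events on values. *)
Lemma minorant_rat (y : R -> R) (a b : R) : sample_space y ->
  (forall q : rat, (ratr q : R) \in `[-1, 1]%R -> a * ratr q + b <= y (ratr q)) ->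
  minorant y a b.
Proof.
move=> sy yq s sI; rewrite leNgt; apply/negP => ys.
have cy : (fun t => y t - a * t) @ within `[-1, 1] (nbhs s) --> y s - a * s.
  move/subspace_continuousP : (sy) => /(_ s sI) cy; apply: cvgB => //.
  apply: cvgM; first exact: cvg_cst.
  by apply: cvg_within_filter; exact: cvg_id.
have /cvgr_lt/(_ b) := cy; rewrite ltrBlDr addrC ys => /(_ isT).
rewrite near_withinE => -[e /= e0 he].
have := sI; rewrite in_itv/= => /andP[s1 s2].
have lt : Num.max (-1) (s - e) < Num.min 1 (s + e).
  by rewrite gt_max !lt_min; apply/andP; split; apply/andP; split; lra.
have [q] := rat_in_itvoo lt; rewrite in_itv/= gt_max lt_min.
move=> /andP[/andP[q1 q2] /andP[q3 q4]].
have qI : (ratr q : R) \in `[-1, 1]%R by rewrite in_itv/= !ltW.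
have := yq _ qI; have : ball s e (ratr q).
  by rewrite /ball/= ltr_norml; lra.
by move=> /he/(_ qI); lra.
Qed.

(** Increase the slope slightly to a rational one and lower the intercept by
    slightly more, so that the line stays below the original one on [[-1, 1]]. *)
Lemma lt_gcm_rat (y : R -> R) (c t : R) : sample_space y ->
  t \in `[-1, 1]%R -> c < gcm y t ->
  exists a b : rat, minorant y (ratr a) (ratr b) /\ c < ratr a * t + ratr b.
Proof.
move=> sy tI cG.
have [a [b [ab cab]]] : exists a b, minorant y a b /\ c < a * t + b.
  apply: contrapT => nab; move: cG; rewrite ltNge => /negP; apply.
  apply: gcm_le => // a b ab; rewrite leNgt; apply/negP => cab.
  by apply: nab; exists a, b.
pose e := a * t + b - c; have e0 : 0 < e by rewrite subr_gt0.
have [a' ] : exists q : rat, (ratr q : R) \in `]a, a + e / 4[%R.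
  by apply: rat_in_itvoo; lra.
have [b' ] : exists q : rat, (ratr q : R) \in `]b - e / 2, b - e / 4[%R.
  by apply: rat_in_itvoo; lra.
rewrite !in_itv/= => /andP[b1 b2] /andP[a1 a2].
exists a', b'; split.
  move=> s sI; have := ab s sI; move: sI; rewrite in_itv/= => /andP[s1 s2].
  have : (ratr a' - a) * s <= (ratr a' - a) * 1 by rewrite ler_wpM2l//; lra.
  lra.
move: tI; rewrite in_itv/= => /andP[t1 t2].
have : (ratr a' - a) * -1 <= (ratr a' - a) * t by rewrite ler_wpM2l//; lra.
have : ratr a' - a < e / 4 by lra.
by rewrite /e in a2 b1 b2 *; lra.
Qed.

Context d (T : measurableType d) (Y : T -> R -> R).
Hypothesis sY : forall w, sample_space (Y w).
Hypothesis mY : forall t, measurable_fun [set: T] (fun w => Y w t).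

Lemma measurable_minorant (a b : R) : measurable [set w | minorant (Y w) a b].
Proof.
rewrite (_ : mkset _ = ~` \bigcup_(q : rat)
    (if (ratr q : R) \in `[-1, 1]%R then [set w | Y w (ratr q) < a * ratr q + b]
     else set0)).
  apply: measurableC; apply: bigcupT_measurable_rat => q; case: ifP => // _.
  rewrite (_ : mkset _ = setT `&` (fun w => Y w (ratr q)) @^-1` `]-oo, a * ratr q + b[).
    exact: mY.
  by apply/seteqP; split => w /=; rewrite in_itv/= => // -[].
apply/seteqP; split => w /=.
  move=> ab [q _]; case: ifP => // qI /=.
  by rewrite ltNge => /negP; apply; exact: ab.
move=> nq; apply: minorant_rat => // q qI; rewrite leNgt; apply/negP => yq.
by apply: nq; exists q => //; rewrite qI.
Qed.

Lemma measurable_gcm t : t \in `[-1, 1]%R ->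
  measurable_fun [set: T] (fun w => gcm (Y w) t).
Proof.
move=> tI; apply: (measurability _ (RGenOInfty.measurableE R)) => //.
move=> _ [_ [c ->] <-]; rewrite setTI.
rewrite (_ : _ @^-1` _ = \bigcup_(a : rat) \bigcup_(b : rat)
   (if c < ratr a * t + ratr b then [set w | minorant (Y w) (ratr a) (ratr b)]
    else set0)).
  apply: bigcupT_measurable_rat => a; apply: bigcupT_measurable_rat => b.
  by case: ifP => // _; exact: measurable_minorant.
apply/seteqP; split => w /=; rewrite in_itv/= andbT.
  move=> /(lt_gcm_rat (@sY w) tI)[a [b [ab cab]]].
  by exists a => //; exists b => //; rewrite cab.
move=> [a _ [b _]]; case: ifP => // cab /= ab.
exact: (lt_le_trans cab (le_gcm tI ab)).
Qed.

Lemma measurable_monotone_lse :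
  measurable_fun [set: T] (fun w => monotone_lse 0 (Y w)).
Proof.
pose u (n : nat) : R := n.+1%:R^-1.
have u0 n : 0 < u n by rewrite invr_gt0.
have u1 n : u n <= 1 by rewrite invf_le1// ler1n.
pose h n w := (gcm (Y w) 0 - gcm (Y w) (0 - u n)) / u n.
apply: (@measurable_fun_cvg _ _ _ _ h) => [n|w _].
  apply: measurable_funM; last exact: measurable_cst.
  apply: measurable_funB; apply: measurable_gcm; rewrite in_itv/=; first lra.
  by have := u0 n; have := u1 n; lra.
have /cvg_at_rightP := is_cvg_gcm_quotient (@sY w); apply.
by split => //; exact: cvg_harmonic.
Qed.

End measurable_lse.

(** * The local scale of a nondecreasing function and the alternative *)

Section scale.
Context {R : realType}.
Implicit Types (n : nat) (delta : R).

(** The noise level [(n delta)^(-1/2)]. *)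
Definition rate n delta : R := (Num.sqrt n%:R)^-1 / Num.sqrt delta.

Lemma rate_gt0 n delta : (0 < n)%N -> 0 < delta -> 0 < rate n delta.
Proof. by move=> n0 d0; rewrite divr_gt0 ?invr_gt0 ?sqrtr_gt0 ?ltr0n. Qed.

Lemma rate_energy n delta : (0 < n)%N -> 0 < delta ->
  rate n delta ^+ 2 * delta * n%:R = 1.
Proof.
move=> n0 d0; have nR : n%:R != 0 :> R by rewrite pnatr_eq0 -lt0n.
rewrite /rate exprMn !exprVn !sqr_sqrtr ?(ltW d0)//.
by field; rewrite nR gt_eqF.
Qed.

(** Along [delta = 4^-k] the rate doubles at each step, so there is a first [k] for
    which [g delta] is below it.  At the previous scale [4 * delta] the function
    exceeds the rate of that scale, which is half of the final one, and it does
    so beyond by monotonicity; if [k = 0], there is nothing beyond [4 * delta]. *)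
Lemma exists_scale n (g : R -> R) : (0 < n)%N ->
  {in `]0, 1]%R &, {homo g : x y / x <= y}} ->
  exists delta, [/\ 0 < delta <= 1, g delta <= rate n delta &
    forall t, t <= 1 -> 4 * delta < t -> rate n delta / 2 <= g t].
Proof.
move=> n0 gm; pose d k : R := (2 ^- k) ^+ 2.
have d0 k : 0 < d k by rewrite exprn_gt0// invr_gt0 exprn_gt0.
have d1 k : d k <= 1.
  apply: exprn_ile1; first by rewrite invr_ge0 exprn_ge0.
  by rewrite invf_le1 ?exprn_gt0// exprn_ege1// ler1n.
have rE k : rate n (d k) = (Num.sqrt n%:R)^-1 * 2 ^+ k.
  by rewrite /rate sqrtr_sqr ger0_norm ?invrK// invr_ge0 exprn_ge0.
have c0 : 0 < (Num.sqrt n%:R)^-1 :> R by rewrite invr_gt0 sqrtr_gt0 ltr0n.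
have exk : exists k, g (d k) <= rate n (d k).
  exists (Num.bound (`|g 1| * Num.sqrt n%:R)); set k := Num.bound _.
  apply: (@le_trans _ _ (g 1)).
    by apply: gm; rewrite ?in_itv/= ?d0 ?d1// ltr01 lexx.
  apply: (le_trans (ler_norm _)).
  rewrite rE mulrC ler_pdivlMr ?sqrtr_gt0 ?ltr0n//.
  apply: (le_trans (ltW (archi_boundP _))); first by rewrite mulr_ge0.
  by rewrite -natrX ler_nat ltnW// ltn_expl.
case: (ex_minnP exk) => k gk kmin; exists (d k); split; rewrite ?d0 ?d1//.
move=> t t1 dt; case: k gk kmin dt => [|k] gk kmin dt.
  by move: dt; rewrite /d expr0 invr1 expr1n; lra.
have dS : d k = 4 * d k.+1.
  by rewrite /d [2 ^+ k.+1]exprS; field; rewrite expf_neq0.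
have lt : rate n (d k) < g (d k).
  by rewrite ltNge; apply/negP => /kmin; rewrite ltnn.
have -> : rate n (d k.+1) / 2 = rate n (d k).
  by rewrite !rE exprS; field; rewrite gt_eqF// sqrtr_gt0 ltr0n.
apply: (le_trans (ltW lt)); apply: gm; rewrite ?in_itv/= ?d0 ?d1//.
  by rewrite t1 andbT (lt_trans _ dt)// -dS.
by rewrite dS ltW.
Qed.

End scale.

Section hypotheses.
Context {R : realType}.
Implicit Types (f : R -> R) (n : nat) (r kappa : R).

(** What the upper bound needs from the windows [dp] on the right and [dm] on the
    left: both bias and noise of order [r]. *)
Definition local_rate n (dp dm r : R) f :=
  [/\ 0 < dp <= 1, 0 < dm <= 1, rate n dp <= r, rate n dm <= r &
      f dp - f 0 <= 2 * r /\ f 0 - f (- dm) <= 2 * r].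

(** What the lower bound needs: a difference [kappa * r] at 0, and a perturbation
    whose squared [L^2] norm is at most [4 * kappa ^+ 2 / n]. *)
Definition alternative n r kappa (f0 f1 : R -> R) :=
  [/\ nondecreasing_11 f1, `|f1 0 - f0 0| = kappa * r &
      exists l l', [/\ l <= l', (kappa * r) ^+ 2 * (l' - l) * n%:R <= 4 * kappa ^+ 2,
        forall x, x \in `[-1, 1]%R -> x \in `[l, l']%R ->
          `|f1 x - f0 x| <= kappa * r &
        forall x, x \in `[-1, 1]%R -> x \notin `[l, l']%R -> f1 x - f0 x = 0]].

(** Perturb on the side with the larger rate [r].  There the scale was chosen so that
    [f0] is at least [r / 2 >= kappa * r] away from [f0 0] beyond [4 * delta], where
    the perturbation is thus invisible. *)
Lemma exists_alternative n kappa f0 : (0 < n)%N -> 0 < kappa <= 1 / 2 ->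
  nondecreasing_11 f0 -> exists f1 r dp dm,
  [/\ 0 < r, local_rate n dp dm r f0, local_rate n dp dm r f1 &
      alternative n r kappa f0 f1].
Proof.
move=> n0 /andP[k0 k12] nd.
have mon x y : -1 <= x -> x <= y -> y <= 1 -> f0 x <= f0 y.
  by move=> x1 xy y1; apply: nd; rewrite ?in_itv//=; lra.
have [dp [dp01 gp farp]] : exists delta, [/\ 0 < delta <= 1,
    f0 delta - f0 0 <= rate n delta &
    forall t, t <= 1 -> 4 * delta < t -> rate n delta / 2 <= f0 t - f0 0].
  apply: (@exists_scale _ n (fun t => f0 t - f0 0)) => // x y.
  by rewrite !in_itv/= => /andP[x0 x1] /andP[y0 y1] xy; rewrite lerD2r mon//; lra.
have [dm [dm01 gm farm]] : exists delta, [/\ 0 < delta <= 1,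
    f0 0 - f0 (- delta) <= rate n delta &
    forall t, t <= 1 -> 4 * delta < t -> rate n delta / 2 <= f0 0 - f0 (- t)].
  apply: (@exists_scale _ n (fun t => f0 0 - f0 (- t))) => // x y.
  rewrite !in_itv/= => /andP[x0 x1] /andP[y0 y1] xy.
  by rewrite lerD2l lerN2 mon//; lra.
have /andP[dp0 dp1] := dp01; have /andP[dm0 dm1] := dm01.
have rp0 := rate_gt0 n0 dp0; have rm0 := rate_gt0 n0 dm0.
have energy delta : 0 < delta ->
    (kappa * rate n delta) ^+ 2 * (4 * delta) * n%:R = 4 * kappa ^+ 2.
  move=> d0; transitivity (4 * kappa ^+ 2 * (rate n delta ^+ 2 * delta * n%:R)).
    by ring.
  by rewrite rate_energy// mulr1.
have [rpm|rmp] := leP (rate n dm) (rate n dp).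
- pose f1 t := if 0 <= t then Num.max (f0 t) (f0 0 + kappa * rate n dp) else f0 t.
  set r := rate n dp in rp0 rpm gp farp f1 *.
  have kr0 : 0 < kappa * r by rewrite mulr_gt0.
  have krr : kappa * r <= r / 2 by nra.
  have f10 : f1 0 = f0 0 + kappa * r by rewrite /f1 lexx max_r// lerDl ltW.
  exists f1, r, dp, dm; split => //.
  + by split => //; split; lra.
  + split => //; have ndm : (0 <= - dm) = false by rewrite leNgt oppr_lt0 dm0.
    rewrite f10 /f1 (ltW dp0) ndm.
    by split; [case: (leP (f0 dp)) => ?; lra|lra].
  + split; last first.
    * exists 0, (4 * dp); split.
      - by rewrite mulr_ge0// ltW.
      - by rewrite subr0 energy.
      - move=> x; rewrite !in_itv/= => /andP[_ x1] /andP[x0 _]; rewrite /f1 x0.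
        have := mon 0 x _ x0 x1.
        case: (leP (f0 x)) => ? h; rewrite ?subrr ?normr0 ?(ltW kr0)//.
        rewrite ger0_norm; last lra.
        have : f0 0 <= f0 x by apply: h; lra.
        lra.
      - move=> x; rewrite !in_itv/= => /andP[xn1 x1]; rewrite negb_and -!ltNge.
        case/orP => h; rewrite /f1; first by rewrite leNgt h subrr.
        rewrite max_l ?if_same ?subrr//.
        have := farp x x1 h; lra.
    * by rewrite f10 addrAC subrr add0r ger0_norm// ltW.
    * move=> x y; rewrite !in_itv/= => /andP[x1 x2] /andP[y1 y2] xy.
      have fxy := mon _ _ x1 xy y2; rewrite /f1.
      case: (leP 0 x) => x0.
        by rewrite (le_trans x0 xy) ge_max !le_max fxy lexx orbT.
      by case: ifP => // _; rewrite le_max fxy.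
- pose f1 t := if t <= 0 then Num.min (f0 t) (f0 0 - kappa * rate n dm) else f0 t.
  set r := rate n dm in rm0 rmp gm farm f1 *.
  have kr0 : 0 < kappa * r by rewrite mulr_gt0.
  have krr : kappa * r <= r / 2 by nra.
  have f10 : f1 0 = f0 0 - kappa * r by rewrite /f1 lexx min_r// gerBl ltW.
  exists f1, r, dp, dm; split => //.
  + by split => //; [exact: ltW|split; lra].
  + split => //; first exact: ltW.
    have ndp : (dp <= 0) = false by rewrite leNgt dp0.
    rewrite f10 /f1 oppr_le0 (ltW dm0) ndp.
    by split; [lra|case: (leP (f0 (- dm))) => ?; lra].
  + split; last first.
    * exists (- (4 * dm)), 0; split.
      - by rewrite oppr_le0 mulr_ge0// ltW.
      - by rewrite sub0r opprK energy.
      - move=> x; rewrite !in_itv/= => /andP[x1 _] /andP[_ x0]; rewrite /f1 x0.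
        have : f0 x <= f0 0 by rewrite mon//; lra.
        case: (leP (f0 x) (f0 0 - kappa * r)) => ? h;
          rewrite ?subrr ?normr0 ?(ltW kr0)//.
        by rewrite ler0_norm; lra.
      - move=> x; rewrite !in_itv/= => /andP[xn1 x1]; rewrite negb_and -!ltNge.
        case/orP => h; rewrite /f1; last by rewrite leNgt h subrr.
        rewrite min_l ?if_same ?subrr//.
        have : r / 2 <= f0 0 - f0 (- (- x)) by apply: farm; lra.
        rewrite opprK; lra.
    * by rewrite f10 addrAC subrr add0r normrN ger0_norm// ltW.
    * move=> x y; rewrite !in_itv/= => /andP[x1 x2] /andP[y1 y2] xy.
      have fxy := mon _ _ x1 xy y2; rewrite /f1.
      case: (leP y 0) => y0.
        by rewrite (le_trans xy y0) le_min !ge_min fxy lexx orbT.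
      by case: ifP => // _; rewrite ge_min fxy.
Qed.

End hypotheses.

(** * Risk of the monotone least squares estimator *)

Section upper_bound.
Context d (T : measurableType d) (R : realType) (P : probability T R)
        (W : R -> {RV P >-> R}).
Hypothesis HW : two_sided_brownian W.

Lemma measurable_lse_error n (f : R -> R) r : nondecreasing_11 f ->
  measurable [set w | r <= `|monotone_lse 0 (observation W n f w) - f 0|].
Proof.
move=> nd; apply: measurable_norm_ge; apply: measurable_funB => //.
apply: measurable_monotone_lse => [w|t]; first exact: observation_sample.
apply: measurable_funD; first exact: measurable_cst.
by apply: measurable_funM; first exact: measurable_cst.
Qed.

(** Slopes of the path are slopes of the primitive of [f], bounded by monotonicity,
    plus slopes of the noise. *)
Lemma lse_bounds n (f : R -> R) (C dp dm : R) (w : T) :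
  nondecreasing_11 f -> 0 < dp <= 1 -> 0 < dm <= 1 ->
  (forall u, dp <= u -> `|W (dp + -1 * u) w - W dp w| <= C * u / Num.sqrt dp) ->
  (forall u, dm <= u -> `|W (- dm + 1 * u) w - W (- dm) w| <= C * u / Num.sqrt dm) ->
  f (- dm) - C * rate n dm <= monotone_lse 0 (observation W n f w)
    <= f dp + C * rate n dp.
Proof.
move=> nd dp01 dm01 Wp Wm; have sy := @observation_sample _ _ _ _ _ HW n f w nd.
have /andP[dp0 dp1] := dp01; have /andP[dm0 dm1] := dm01.
have c0 : 0 <= (Num.sqrt n%:R)^-1 :> R by rewrite invr_ge0.
apply/andP; split.
  apply: (monotone_lse_ge sy dm01) => t /andP[t0 t1].
  have := Wm (t + dm); rewrite mul1r addrCA addNr addr0 => /(_ _)/ler_normlP[|Wt _].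
    by rewrite lerDr.
  have := primitive0_increment_ge nd (_ : -1 <= - dm) (_ : - dm <= t) t1.
  rewrite opprK => /(_ _ _) Ft; have {}Ft := Ft ltac:(lra) ltac:(lra).
  have := ler_wpM2l c0 Wt.
  rewrite /observation /rate.
  have -> : (Num.sqrt n%:R)^-1 * (C * (t + dm) / Num.sqrt dm) =
    C * ((Num.sqrt n%:R)^-1 / Num.sqrt dm) * (t + dm) by ring.
  nra.
apply: (monotone_lse_le sy dp01) => s /andP[s1 s0].
have := Wp (dp - s); rewrite mulN1r opprB addrCA subrr addr0.
move=> /(_ _)/ler_normlP[|Wt _].
  by rewrite lerDl oppr_ge0.
have := primitive0_increment_le nd s1 (_ : s <= dp) dp1.
move=> Ft; have {}Ft := Ft ltac:(lra).
have := ler_wpM2l c0 Wt.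
rewrite /observation /rate.
have -> : (Num.sqrt n%:R)^-1 * (C * (dp - s) / Num.sqrt dp) =
  C * ((Num.sqrt n%:R)^-1 / Num.sqrt dp) * (dp - s) by ring.
nra.
Qed.

(** The error is at most [(2 + C) * r] outside the exceptional events of the two
    windows, of probability [alpha / 2] each. *)
Lemma lse_risk (alpha : R) : 0 < alpha -> exists2 C : R, 0 < C &
  forall n (f : R -> R) dp dm r, (0 < n)%N -> nondecreasing_11 f ->
    0 < r -> local_rate n dp dm r f ->
    (error_prob W n (monotone_lse 0) f ((3 + C) * r) <= alpha%:E)%E.
Proof.
move=> a0; have a2 : 0 < alpha / 2 by rewrite divr_gt0.
have [C C0 HC] := brownian_modulus HW a2; exists C => // n f dp dm r n0 nd r0.
move=> [dp01 dm01 rp rm [fp fm]].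
have /andP[dp0 _] := dp01; have /andP[dm0 _] := dm01.
have [Ep [mEp PEp Hp]] := HC dp dp (-1) dp0 (normrN1 R).
have [Em [mEm PEm Hm]] := HC dm (- dm) 1 dm0 (normr1 R).
apply: (@le_trans _ _ (P (Ep `|` Em))).
  apply: le_measure; rewrite ?inE; [exact: measurable_lse_error|exact: measurableU|].
  move=> w /= err; apply: contrapT => /not_orP[nEp nEm].
  have := lse_bounds n nd dp01 dm01 (Hp w nEp) (Hm w nEm).
  move: err; set l := monotone_lse _ _ => err /andP[l1 l2].
  have Cp : C * rate n dp <= C * r by rewrite ler_wpM2l// ltW.
  have Cm : C * rate n dm <= C * r by rewrite ler_wpM2l// ltW.
  have : `|l - f 0| <= (2 + C) * r by rewrite ler_norml; apply/andP; split; nra.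
  nra.
apply: (le_trans (measureU2 _ mEp mEm)).
by apply: (le_trans (leeD PEp PEm)); rewrite -EFinD -splitr.
Qed.

End upper_bound.


(** * Conclusion *)

Lemma limn_esup_le (R : realType) (u : nat -> \bar R) (a : \bar R) :
  (forall n, (0 < n)%N -> (u n <= a)%E) -> (limn_esup u <= a)%E.
Proof.
move=> ua; rewrite limn_esup_lim; apply: lime_le; first exact: is_cvg_esups.
exists 1%N => // n /= n1; apply: ge_ereal_sup => _ [k /= nk <-].
by apply: ua; exact: leq_trans nk.
Qed.

Lemma limn_einf_ge (R : realType) (u : nat -> \bar R) (a : \bar R) :
  (forall n, (0 < n)%N -> (a <= u n)%E) -> (a <= limn_einf u)%E.
Proof.
move=> ua; rewrite limn_einf_lim; apply: lime_ge; first exact: is_cvg_einfs.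
exists 1%N => // n /= n1; apply: le_ereal_inf_tmp => _ [k /= nk <-].
by apply: ua; exact: leq_trans nk.
Qed.

(** From [expR x <= (1 - x)^-1], for [x = eps^2 / 4]. *)
Lemma energy_small (R : realType) (eps : R) : 0 < eps <= 1 ->
  expR (4 * (eps / 4) ^+ 2) - 1 <= eps ^+ 2.
Proof.
move=> /andP[e0 e1]; set x := 4 * _.
have xE : x = eps ^+ 2 / 4 by rewrite /x; field.
have e2 : eps ^+ 2 <= 1 by rewrite expr_le1// ltW.
have x1 : 0 < 1 - x by rewrite xE; lra.
have : expR x <= (1 - x)^-1.
  rewrite -[expR x]invrK -expRN lef_pV2 ?posrE ?expR_gt0//.
  by have := expR_ge1Dx (- x).
move=> h; rewrite lerBlDr; apply: (le_trans h).
have ee : 0 <= eps ^+ 2 by rewrite sqr_ge0.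
by rewrite -[_^-1]mul1r ler_pdivrMr// xE; nra.
Qed.

Theorem theorem1p4 (R : realType) (d : measure_display) (T : measurableType d)
    (P : probability T R) (W : R -> {RV P >-> R})
    (HW : two_sided_brownian W)
    (f0 : R -> R) (f0_nondecreasing : nondecreasing_11 f0)
    (f0_L2 : square_integrable_11 f0) (f0_continuous : {for 0, continuous f0})
    (alpha beta : R) (alpha01 : 0 < alpha < 1) (beta012 : 0 < beta < 2^-1) :
  exists2 eta : R, 0 < eta &
  exists (f1 : nat -> R -> R) (gamma : nat -> R),
    [/\ \forall n \near \oo, [/\ nondecreasing_11 (f1 n),
          square_integrable_11 (f1 n) & 0 < gamma n],
        (limn_esup (fun n =>
           maxe (error_prob W n (monotone_lse 0) f0 (gamma n))
                (error_prob W n (monotone_lse 0) (f1 n) (gamma n)))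
         <= alpha%:E)%E &
        (beta%:E < limn_einf (fun n =>
           ereal_inf [set maxe (error_prob W n theta f0 (eta * gamma n))
                               (error_prob W n theta (f1 n) (eta * gamma n))
                     | theta in @estimator R]))%E].
Proof.
have /andP[a0 _] := alpha01; have /andP[b0 b1] := beta012.
have [C C0 risk] := lse_risk HW a0.
(* This makes [(1 - eps) / 2] the midpoint of [beta] and [1 / 2]. *)
pose eps := (1 - 2 * beta) / 2; have eps01 : 0 < eps <= 1 by rewrite /eps; lra.
have /andP[eps0 _] := eps01.
pose kappa := eps / 4; have kappa12 : 0 < kappa <= 1 / 2 by rewrite /kappa; lra.
have /andP[kappa0 _] := kappa12.
have ex n : exists p : (R -> R) * R, (0 < n)%N ->
    exists dp dm, [/\ 0 < p.2, local_rate n dp dm p.2 f0,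
      local_rate n dp dm p.2 p.1 & alternative n p.2 kappa f0 p.1].
  have [->|n0] := posnP n; first by exists (f0, 0).
  have [f1 [r [dp [dm H]]]] := exists_alternative n0 kappa12 f0_nondecreasing.
  by exists (f1, r) => _; exists dp, dm.
have [g Hg] := choice ex.
exists (kappa / (2 * (3 + C))); first by rewrite divr_gt0// mulr_gt0// addr_gt0.
exists (fun n => (g n).1), (fun n => (3 + C) * (g n).2); split.
- exists 1%N => // n /= n1; have [dp [dm [r0 _ _ [nd _ _]]]] := Hg n n1.
  split => //; first exact: nondecreasing_11_square_integrable.
  by rewrite mulr_gt0// addr_gt0.
- apply: limn_esup_le => n n0; have [dp [dm [r0 l0 l1 [nd _ _]]]] := Hg n n0.
  by rewrite ge_max (risk _ _ _ _ _ n0 _ r0 l0)// (risk _ _ _ _ _ n0 _ r0 l1).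
apply: (@lt_le_trans _ _ ((1 - eps) / 2)%:E); first by rewrite lte_fin /eps; lra.
apply: limn_einf_ge => n n0; apply: le_ereal_inf_tmp => _ [theta th <-].
have [dp [dm [r0 _ _ [nd gap [l [l' [ll en bin bout]]]]]]] := Hg n n0.
apply: (minimax_lower_bound HW n0 f0_nondecreasing nd th _ ll _ eps0 bin bout).
- rewrite gap le_eqVlt; apply/orP; left; apply/eqP.
  by field; rewrite gt_eqF// addr_gt0.
- by rewrite mulr_ge0// ltW.
- apply: le_trans (energy_small eps01); rewrite lerD2r ler_expR.
  exact: en.
Qed.
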